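(* Set $D=\{0,1\}^m\smallsetminus\{\mathbf 0\}$ and, for every $i\in\{1,\dots,m\}$, let $A_i\colon H_i\to2^{H_i}$ be maximally monotone and let $B_i\colon\mathbf H\to H_i$. Suppose that $$(\exists\,\vartheta\in(0,+\infty))(\forall\mathbf x\in\mathbf H)(\forall\mathbf y\in\mathbf H)\quad\sum_{i=1}^m\langle x_i-y_i\mid B_i\mathbf x-B_i\mathbf y\rangle\ge\vartheta\sum_{i=1}^m\|B_i\mathbf x-B_i\mathbf y\|^2,$$ and that the set $\mathbf F$ of solutions to the problem $$\text{find } x_1\in H_1,\dots,x_m\in H_m\ \text{ such that }\ (\forall i\in\{1,\dots,m\})\quad 0\in A_ix_i+B_i(x_1,\dots,x_m)$$ is nonempty. Let $(\gamma_n)_{n\in\mathbb N}$ be a sequence in $(0,2\vartheta)$ such that $\inf_{n\in\mathbb N}\gamma_n>0$ and $\sup_{n\in\mathbb N}\gamma_n<2\vartheta$, and let $(\lambda_n)_{n\in\mathbb N}$ be a sequence in $(0,1]$ such that $\inf_{n\in\mathbb N}\lambda_n>0$. Let $\boldsymbol x_0$, $(\boldsymbol a_n)_{n\in\mathbb N}$, and $(\boldsymbol c_n)_{n\in\mathbb N}$ be $\mathbf H$-valued random variables, and let $(\boldsymbol\varepsilon_n)_{n\in\mathbb N}$ be identically distributed $D$-valued random variables. Iterate, for $n=0,1,\dots$ and for $i=1,\dots,m$, $$x_{i,n+1}=x_{i,n}+\varepsilon_{i,n}\lambda_n\Big(J_{\gamma_nA_i}\big(x_{i,n}-\gamma_n(B_i(x_{1,n},\dots,x_{m,n})+c_{i,n})\big)+a_{i,n}-x_{i,n}\Big),$$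 and set $(\forall n\in\mathbb N)$ $\mathcal E_n=\sigma(\boldsymbol\varepsilon_n)$. Furthermore, assume that the following hold: (i) $\sum_{n\in\mathbb N}\sqrt{\mathsf E(\|\boldsymbol a_n\|^2\mid\mathcal X_n)}<+\infty$ and $\sum_{n\in\mathbb N}\sqrt{\mathsf E(\|\boldsymbol c_n\|^2\mid\mathcal X_n)}<+\infty$. (ii) For every $n\in\mathbb N$, $\mathcal E_n$ and $\mathcal X_n$ are independent. (iii) $(\forall i\in\{1,\dots,m\})$ $\mathsf P[\varepsilon_{i,0}=1]>0$. Then $(\boldsymbol x_n)_{n\in\mathbb N}$ converges weakly $\mathsf P$-a.s. to an $\mathbf F$-valued random variable $\boldsymbol x$. If, in addition, one of the following holds: (iv) for every $\mathbf x\in\mathbf F$ and every $i\in\{1,\dots,m\}$, $A_i$ is demiregular at $x_i$; (v) the operator $\mathbf x\mapsto(B_i\mathbf x)_{1\le i\le m}$ is demiregular at every point in $\mathbf F$; then $(\boldsymbol x_n)_{n\in\mathbb N}$ converges strongly $\mathsf P$-a.s. to $\boldsymbol x$.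
   Context: $H_1,\dots,H_m$ are separable real Hilbert spaces and $\mathbf H=H_1\oplus\cdots\oplus H_m$ is their direct Hilbert sum; scalar products and norms are denoted $\langle\cdot\mid\cdot\rangle$ and $\|\cdot\|$, and $\mathbf x=(x_1,\dots,x_m)$ is a generic vector in $\mathbf H$. $(\Omega,\mathcal F,\mathsf P)$ is the underlying probability space; random variables with values in a Hilbert space are Borel-measurable maps from $\Omega$. For $\boldsymbol x_n=(x_{1,n},\dots,x_{m,n})$, $\mathcal X_n=\sigma(\boldsymbol x_0,\dots,\boldsymbol x_n)$. Components: $\boldsymbol a_n=(a_{i,n})_{1\le i\le m}$, $\boldsymbol c_n=(c_{i,n})_{1\le i\le m}$, $\boldsymbol\varepsilon_n=(\varepsilon_{i,n})_{1\le i\le m}$. For a set-valued operator $A\colon H\to2^H$ on a real Hilbert space $H$, the resolvent is $J_A=(\mathrm{Id}+A)^{-1}$ (single-valued, nonexpansive and defined everywhere when $A$ is maximally monotone), $\operatorname{dom}A=\{x\in H: Ax\neq\varnothing\}$ and $\operatorname{gra}A=\{(x,u)\in H\times H:u\in Ax\}$. $A$ is demiregular at $x\in\operatorname{dom}A$ if, for every sequence $((x_n,u_n))_{n\in\mathbb N}$ in $\operatorname{gra}A$ and every $u\in Ax$ such that $x_n\rightharpoonup x$ (weakly) and $u_n\to u$ (strongly), we have $x_n\to x$ (strongly). Equalities and inequalities involving random variables are understood to hold $\mathsf P$-almost surely. *)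

(* Defs.v *)
From HB Require Import structures.
From mathcomp Require Import all_boot all_order all_algebra.
From mathcomp Require Import all_classical all_reals all_analysis.
From mathcomp Require Import measurable_realfun.
From mathcomp Require Import ring lra.

Set Implicit Arguments.
Unset Strict Implicit.
Unset Printing Implicit Defensive.

Import Order.TTheory GRing.Theory Num.Theory.
Import numFieldNormedType.Exports.

Local Open Scope classical_set_scope.
Local Open Scope ring_scope.

(* Positive definiteness of [inner] follows from [inner_normE] and the norm
   axioms. *)

HB.mixin Record CompleteNormedModule_isHilbert (R : realType) H
    & CompleteNormedModule R H := {
  inner : H -> H -> R;
  innerC : forall x y, inner x y = inner y x;
  innerDl : forall x y z, inner (x + y) z = inner x z + inner y z;
  innerZl : forall (k : R) x y, inner (k *: x) y = k * inner x y;
  inner_normE : forall x, inner x x = `|x| ^+ 2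
}.

#[short(type="hilbertType")]
HB.structure Definition Hilbert (R : realType) :=
  {H of CompleteNormedModule R H & CompleteNormedModule_isHilbert R H}.

Definition separable (T : topologicalType) :=
  exists S : set T, countable S /\ dense S.

Lemma cauchy_schwarz_sum (R : realType) (I : finType) (f g : I -> R) :
  (\sum_i f i * g i) ^+ 2 <= (\sum_i f i ^+ 2) * (\sum_i g i ^+ 2).
Proof.
set p := \sum_i f i * g i.
set q := \sum_i f i ^+ 2.
set r := \sum_i g i ^+ 2.
have quad t : 0 <= t ^+ 2 * q + 2 * t * p + r.
  have -> : t ^+ 2 * q + 2 * t * p + r = \sum_i (t * f i + g i) ^+ 2.
    rewrite /p /q /r !mulr_sumr -!big_split /=.
    by apply: eq_bigr => i _; ring.
  by apply: sumr_ge0 => i _; exact: sqr_ge0.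
have q0 : 0 <= q by apply: sumr_ge0 => i _; exact: sqr_ge0.
have [q1|q1] := eqVneq q 0.
  suff -> : p = 0 by rewrite q1 expr0n/= mul0r.
  have f0 i : f i = 0.
    have /eqP : q = 0 by [].
    rewrite psumr_eq0 => [/allP/(_ i)|j _]; last exact: sqr_ge0.
    by rewrite mem_index_enum sqrf_eq0 => /(_ isT) /eqP.
  by apply: big1 => i _; rewrite f0 mul0r.
have qp : 0 < q by rewrite lt_def q1.
have := quad (- p / q).
have -> : (- p / q) ^+ 2 * q + 2 * (- p / q) * p + r = r - p ^+ 2 / q by field.
by rewrite subr_ge0 ler_pdivrMr// mulrC.
Qed.

Section direct_sum.
Context {R : realType} {m : nat}.

(* The direct Hilbert sum.  The alias keeps the l2 norm below apart from the
   product topology that the library may put on [forall i, H i]. *)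
Definition hsum (H : 'I_m -> hilbertType R) : Type := forall i, H i.

Context (H : 'I_m -> hilbertType R).
Implicit Types x y z : hsum H.

HB.instance Definition _ := Choice.copy (hsum H) (forall i, H i).

Definition hsum_zero : hsum H := fun=> 0.
Definition hsum_opp x : hsum H := fun i => - x i.
Definition hsum_add x y : hsum H := fun i => x i + y i.
Definition hsum_scale (k : R) x : hsum H := fun i => k *: x i.

Fact hsum_addA : associative hsum_add.
Proof. by move=> x y z; apply/functional_extensionality_dep => i; exact: addrA. Qed.
Fact hsum_addC : commutative hsum_add.
Proof. by move=> x y; apply/functional_extensionality_dep => i; exact: addrC. Qed.
Fact hsum_add0 : left_id hsum_zero hsum_add.
Proof. by move=> x; apply/functional_extensionality_dep => i; exact: add0r. Qed.
Fact hsum_addN : left_inverse hsum_zero hsum_opp hsum_add.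
Proof. by move=> x; apply/functional_extensionality_dep => i; exact: addNr. Qed.

HB.instance Definition _ := GRing.isZmodule.Build (hsum H)
  hsum_addA hsum_addC hsum_add0 hsum_addN.

Fact hsum_scaleA k l x : hsum_scale k (hsum_scale l x) = hsum_scale (k * l) x.
Proof. by apply/functional_extensionality_dep => i; exact: scalerA. Qed.
Fact hsum_scale1 : left_id 1 hsum_scale.
Proof. by move=> x; apply/functional_extensionality_dep => i; exact: scale1r. Qed.
Fact hsum_scaleDr : right_distributive hsum_scale +%R.
Proof. by move=> k x y; apply/functional_extensionality_dep => i; exact: scalerDr. Qed.
Fact hsum_scaleDl x : {morph hsum_scale^~ x : k l / k + l}.
Proof. by move=> k l; apply/functional_extensionality_dep => i; exact: scalerDl. Qed.

HB.instance Definition _ := GRing.Zmodule_isLmodule.Build R (hsum H)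
  hsum_scaleA hsum_scale1 hsum_scaleDr hsum_scaleDl.

Definition hsum_inner x y : R := \sum_i inner (x i) (y i).
Definition hsum_norm x : R := Num.sqrt (\sum_i `|x i| ^+ 2).

Let sumsq_ge0 x : 0 <= \sum_i `|x i| ^+ 2.
Proof. by apply: sumr_ge0 => i _; exact: sqr_ge0. Qed.

Fact hsum_normD x y : hsum_norm (x + y) <= hsum_norm x + hsum_norm y.
Proof.
rewrite -(@ler_pXn2r _ 2)// ?nnegrE ?addr_ge0 ?sqrtr_ge0//.
rewrite sqrrD !sqr_sqrtr//.
apply: (@le_trans _ _ (\sum_i (`|x i| + `|y i|) ^+ 2)).
  apply: ler_sum => i _; rewrite ler_pXn2r// ?nnegrE ?addr_ge0//.
  exact: ler_normD.
under eq_bigr do rewrite sqrrD -mulr_natl.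
rewrite !big_split /= lerD2r lerD2l -mulr_sumr -[leRHS]mulr_natl ler_pM2l//.
rewrite -sqrtrM// -[leLHS]ger0_norm; last first.
  by apply: sumr_ge0 => i _; rewrite mulr_ge0.
by rewrite -sqrtr_sqr ler_wsqrtr// cauchy_schwarz_sum.
Qed.

Fact hsum_normZ (k : R) x : hsum_norm (k *: x) = `|k| * hsum_norm x.
Proof.
rewrite /hsum_norm.
under eq_bigr do rewrite normrZ exprMn.
by rewrite -mulr_sumr sqrtrM ?sqr_ge0// sqrtr_sqr normr_id.
Qed.

Lemma hsum_norm_ge x i : `|x i| <= hsum_norm x.
Proof.
rewrite -[`|x i|]ger0_norm// -sqrtr_sqr ler_wsqrtr// (bigD1 i)//=.
by rewrite lerDl sumr_ge0// => j _; exact: sqr_ge0.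
Qed.

Lemma hsum_norm_le x : hsum_norm x <= \sum_i `|x i|.
Proof.
rewrite -(@ler_pXn2r _ 2)// ?nnegrE ?sqrtr_ge0 ?sumr_ge0//.
rewrite sqr_sqrtr// expr2 mulr_suml; apply: ler_sum => i _.
rewrite expr2 ler_wpM2l// (bigD1 i)//= lerDl.
by rewrite sumr_ge0.
Qed.

Fact hsum_norm0_eq0 x : hsum_norm x = 0 -> x = 0.
Proof.
move=> x0; apply/functional_extensionality_dep => i; apply/eqP.
by rewrite -normr_le0 -x0 hsum_norm_ge.
Qed.

HB.instance Definition _ := Lmodule_isNormed.Build R (hsum H)
  hsum_normD hsum_normZ hsum_norm0_eq0.

Fact hsum_complete (F : set_system (hsum H)) :
  ProperFilter F -> cauchy F -> cvg F.
Proof.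
move=> FF /cauchyP Fc.
have cvgF i : cvg ((fun x : hsum H => x i) @ F).
  apply: cauchy_cvg; apply/cauchyP => e e0.
  have [x Fx] := Fc e e0; exists (x i).
  suff : F [set y : hsum H | ball (x i) e (y i)] by [].
  apply: filterS Fx => y.
  rewrite -!ball_normE /= => xy; apply: le_lt_trans xy.
  exact: (hsum_norm_ge (x - y) i).
apply/cvg_ex; exists (fun i => lim ((fun x : hsum H => x i) @ F)).
apply/cvgrPdist_lt => e e0.
have d0 : 0 < e / m.+1%:R by rewrite divr_gt0.
have : \forall x \near F, forall i,
    `|lim ((fun y : hsum H => y i) @ F) - x i| < e / m.+1%:R.
  by apply: filter_forall => i; move/cvgrPdist_lt: (cvgF i); exact.
apply: filterS => x xe.
apply: (le_lt_trans (hsum_norm_le _)).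
apply: (@le_lt_trans _ _ (\sum_(i < m) e / m.+1%:R)).
  by apply: ler_sum => i _; exact/ltW/xe.
rewrite sumr_const card_ord -[ltLHS]mulr_natr mulrAC ltr_pdivrMr//.
by rewrite ltr_pM2l// ltr_nat.
Qed.

HB.instance Definition _ := Uniform_isComplete.Build (hsum H) hsum_complete.

Fact hsum_innerC x y : hsum_inner x y = hsum_inner y x.
Proof. by apply: eq_bigr => i _; exact: innerC. Qed.
Fact hsum_innerDl x y z :
  hsum_inner (x + y) z = hsum_inner x z + hsum_inner y z.
Proof. by rewrite -big_split; apply: eq_bigr => i _; exact: innerDl. Qed.
Fact hsum_innerZl k x y : hsum_inner (k *: x) y = k * hsum_inner x y.
Proof. by rewrite mulr_sumr; apply: eq_bigr => i _; exact: innerZl. Qed.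
Fact hsum_inner_normE x : hsum_inner x x = `|x| ^+ 2.
Proof.
rewrite [RHS]sqr_sqrtr//.
by apply: eq_bigr => i _; exact: inner_normE.
Qed.

HB.instance Definition _ := CompleteNormedModule_isHilbert.Build R (hsum H)
  hsum_innerC hsum_innerDl hsum_innerZl hsum_inner_normE.

End direct_sum.

Section operators.
Context {R : realType} {H : hilbertType R}.
Implicit Types (A : H -> set H) (x y u v : H).

Definition weak_cvg (s : nat -> H) x :=
  forall y, inner (s n) y @[n --> \oo] --> inner x y.

Definition dom A : set H := [set x | A x !=set0].

Definition gra A : set (H * H) := [set p | A p.1 p.2].

Definition monotone A :=
  forall x u y v, gra A (x, u) -> gra A (y, v) -> 0 <= inner (x - y) (u - v).

Definition maximally_monotone A :=
  monotone A /\
  forall A', monotone A' -> gra A `<=` gra A' -> gra A' = gra A.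

Definition op_scale (k : R) A : H -> set H := fun x => [set k *: u | u in A x].

Definition op_id_add A : H -> set H := fun x => [set x + u | u in A x].

Definition op_inv A : H -> set H := fun u => [set x | A x u].

(* J_A = (Id + A)^-1 as a map: for maximally monotone A each value of
   [op_inv (op_id_add A)] is a singleton; 0 is returned on empty values. *)
Definition resolvent A : H -> H := fun y => xget 0 (op_inv (op_id_add A) y).

Definition demiregular A x :=
  dom A x /\
  forall (xs us : nat -> H) u,
    (forall n, gra A (xs n, us n)) -> A x u ->
    weak_cvg xs x -> us n @[n --> \oo] --> u -> xs n @[n --> \oo] --> x.

End operators.

Section probability.
Context {d : measure_display} {T : measurableType d} {R : realType}.
Implicit Type (P : probability T R).

Definition borel (X : ptopologicalType) := g_sigma_algebraType (@open X).

Definition borel_rv (X : ptopologicalType) (f : T -> X) :=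
  measurable_fun [set: T] (f : T -> borel X).

Definition sigma_upto (X : ptopologicalType) (x : nat -> T -> X) (n : nat) :
    set_system T :=
  <<s \bigcup_(k in `I_n.+1)
        preimage_set_system [set: T] (x k) (@measurable _ (borel X)) >>.

Definition independent_systems P (F G : set_system T) :=
  forall A B, F A -> G B -> P (A `&` B) = (P A * P B)%E.

(* [g] is a version of E(f | G) for a nonnegative [f], which need not be
   integrable; such a version exists and is unique up to P-null sets. *)
Definition is_cond_expectation P (G : set_system T) (f g : T -> \bar R) :=
  [/\ forall w, (0 <= g w)%E,
      forall B : set (\bar R), measurable B -> G (g @^-1` B) &
      forall A, G A -> (\int[P]_(w in A) g w = \int[P]_(w in A) f w)%E].

(* The finite type D = {0,1}^m \ {0}, with the discrete sigma-algebra. *)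
Definition sweep (m : nat) := {e : {ffun 'I_m -> bool} | e != [ffun=> false]}.

Definition sweep_rv (m : nat) (e : T -> sweep m) :=
  forall S : set (sweep m), measurable (e @^-1` S).

Definition sigma_sweep (m : nat) (e : T -> sweep m) : set_system T :=
  preimage_set_system [set: T] e [set: set (sweep m)].

Definition identically_distributed P (m : nat) (e : nat -> T -> sweep m) :=
  forall n k (S : set (sweep m)), P (e n @^-1` S) = P (e k @^-1` S).

End probability.

Definition inclusion_solutions (R : realType) (m : nat)
    (H : 'I_m -> hilbertType R) (A : forall i, H i -> set (H i))
    (B : forall i, hsum H -> H i) : set (hsum H) :=
  [set x | forall i, [set u + B i x | u in A i (x i)] 0].

(* Main.v *)
Require Import Defs.
From HB Require Import structures.
From mathcomp Require Import all_boot all_order all_algebra.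
From mathcomp Require Import all_classical all_reals all_analysis.
From mathcomp Require Import measurable_realfun.
From mathcomp Require Import ring lra.

Set Implicit Arguments.
Unset Strict Implicit.
Unset Printing Implicit Defensive.

Import Order.TTheory GRing.Theory Num.Theory.
Import numFieldNormedType.Exports.

Local Open Scope classical_set_scope.
Local Open Scope ring_scope.

(** The iteration activates a random set of coordinates of the forward-backward
    map.  Write p_i for the probability that coordinate i is activated and
    measure distances in the norm (sum_i |x_i|^2 / p_i)^(1/2).  The mean over one
    sweep of the squared weighted distance to a solution z then equals the old
    value minus |x - z|^2 plus the squared distance of the full relaxed
    forward-backward step to z ([sweep_mean_sqnorm]).  Cocoercivity of B and
    firm nonexpansiveness of the resolvents make that difference at most
    - k times a residual that vanishes only if B x = B z and x is a fixed point
    ([fwd_bwd_ineq], [relaxed_step_ineq]).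

    It pays to work with the unsquared distance V_n: errors then enter
    additively, and the conditional mean of V_{n+1} is at most
    V_n - (residual term) + (error term) ([sweep_mean_norm], [mean_step]).
    Independence of the sweep from the past replaces the random sweep by its
    mean, and the conditional second moments of the errors bound their
    conditional first moments ([cond_jensen_sqrt]); both are instances of one
    pull-out property ([sub_integralM]).  The iterates are not assumed to be
    integrable, so all these inequalities are stated between integrals of
    nonnegative functions over events of the past.

    A theorem of Robbins and Siegmund ([almost_supermartingale_cvg]) gives, almost
    surely, convergence of V_n and vanishing residuals.  It is proved by
    Doob's upcrossing argument, written with a nonnegative potential that is
    itself an almost supermartingale, after killing the process when its
    accumulated errors exceed a bound.  A countable dense set of solutions z
    yields one almost sure event on which V_n converges for every solution.

    The rest is deterministic ([fwd_bwd_cvg]).  Residuals tending to 0 and the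
    weak-strong closedness of the graphs of the A_i make every weak cluster point
    a solution, and Opial's argument ([opial]) in the weighted norm gives weak
    convergence.  Weak cluster points are taken along ultrafilters, where
    bounded sequences converge weakly by compactness of segments and the Riesz
    representation theorem.  For strong convergence, demiregularity of
    the A_i is applied to the resolvent points, and that of B to the iterates
    themselves.

    That the resolvents are defined everywhere is Minty's theorem.  It and the
    Riesz theorem both come from minimising t + |x|^2 / 2 over a closed
    convex set ([strongly_convex_min]). *)

(** * Inner products and limits *)

Lemma norm_le_cvg0 (R : realType) (V : normedModType R) (I : Type)
    (F : set_system I) {FF : Filter F} (f : I -> V) (g : I -> R) :
  (forall i, `|f i| <= g i) -> g @ F --> 0 -> f @ F --> 0.
Proof.
move=> fg g0; apply/norm_cvg0P.
apply: (squeeze_cvgr (f := cst 0) (h := g)) => //; last exact: cvg_cst.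
by apply: nearW => i; rewrite normr_ge0 fg.
Qed.

Section hilbert.
Context {R : realType} {H : hilbertType R}.
Implicit Types x y z : H.

Lemma innerDr x y z : inner x (y + z) = inner x y + inner x z.
Proof. by rewrite innerC innerDl !(innerC x). Qed.

Lemma innerZr (k : R) x y : inner x (k *: y) = k * inner x y.
Proof. by rewrite innerC innerZl (innerC x). Qed.

Lemma innerNl x y : inner (- x) y = - inner x y.
Proof. by rewrite -scaleN1r innerZl mulN1r. Qed.

Lemma innerNr x y : inner x (- y) = - inner x y.
Proof. by rewrite innerC innerNl innerC. Qed.

Lemma inner0l y : inner (0 : H) y = 0.
Proof. by have := innerZl 0 y y; rewrite scale0r mul0r. Qed.

Lemma inner0r y : inner y (0 : H) = 0.
Proof. by rewrite innerC inner0l. Qed.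

Definition innerE := (@innerDl R H, @innerDr, @innerNl, @innerNr, @innerZl R H, @innerZr).

Lemma sqr_normD x y : `|x + y| ^+ 2 = `|x| ^+ 2 + 2 * inner x y + `|y| ^+ 2.
Proof. by rewrite -!inner_normE !innerE (innerC y x); ring. Qed.

Lemma sqr_normB x y : `|x - y| ^+ 2 = `|x| ^+ 2 - 2 * inner x y + `|y| ^+ 2.
Proof. by rewrite -!inner_normE !innerE (innerC y x); ring. Qed.

Lemma cauchy_schwarz x y : `|inner x y| <= `|x| * `|y|.
Proof.
have [->|x0] := eqVneq x 0; first by rewrite inner0l !normr0 mul0r.
have xx : 0 < `|x| ^+ 2 by rewrite exprn_gt0// normr_gt0.
rewrite -(@ler_pXn2r _ 2)// ?nnegrE ?mulr_ge0// exprMn real_normK ?num_real//.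
have := sqr_ge0 `|inner x y *: x - `|x| ^+ 2 *: y|.
rewrite sqr_normB !normrZ !exprMn !innerE !real_normK ?num_real//.
rewrite [X in 0 <= X](_ : _ =
  `|x| ^+ 2 * (`|x| ^+ 2 * `|y| ^+ 2 - inner x y ^+ 2)); last by ring.
by rewrite pmulr_rge0// subr_ge0.
Qed.

Lemma inner_le x y : inner x y <= `|x| * `|y|.
Proof. exact: le_trans (ler_norm _) (cauchy_schwarz x y). Qed.

(** Boundedness of f absorbs the error made by replacing g by its strong limit
    v, so that weak convergence of f need only be tested on v itself. *)
Lemma inner_cvg_bounded (I : Type) (F : set_system I) {FF : Filter F}
    (f g : I -> H) (M : R) (l : R) (v : H) :
  (forall i, `|f i| <= M) -> inner (f i) v @[i --> F] --> l ->
  g @ F --> v -> inner (f i) (g i) @[i --> F] --> l.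
Proof.
move=> fM fv gv.
rewrite (_ : (fun i => _) = (fun i => inner (f i) v + inner (f i) (g i - v))); last first.
  by apply/funext => i; rewrite !innerE; ring.
rewrite -[l]addr0; apply: cvgD => //.
apply: (@norm_le_cvg0 _ _ _ _ FF _ (fun i => M * `|g i - v|)).
  move=> i; apply: le_trans (cauchy_schwarz _ _) _; exact: ler_wpM2r.
by rewrite -(mulr0 M); apply: cvgMr; apply/norm_cvg0P/subr_cvg0.
Qed.

Lemma inner_cvgr (I : Type) (F : set_system I) {FF : Filter F}
    (g : I -> H) (u v : H) :
  g @ F --> v -> inner u (g i) @[i --> F] --> inner u v.
Proof.
by move=> gv; apply: (@inner_cvg_bounded _ _ _ (fun=> u) _ `|u|) gv => //; exact: cvg_cst.
Qed.

Lemma inner_cvgl (I : Type) (F : set_system I) {FF : Filter F}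
    (g : I -> H) (u v : H) :
  g @ F --> v -> inner (g i) u @[i --> F] --> inner v u.
Proof.
by move=> gv; under eq_fun do rewrite innerC; rewrite innerC; exact: inner_cvgr.
Qed.

End hilbert.

(** * Minimisation of strongly convex functions *)

Section strongly_convex_minimisation.
Context {R : realType} {H : hilbertType R} (E : set (H * R)).
Hypothesis E_neq0 : E !=set0.
Hypothesis E_convex : forall p q (s : R), E p -> E q -> 0 <= s <= 1 ->
  E (p.1 + s *: (q.1 - p.1), p.2 + s * (q.2 - p.2)).
Hypothesis E_closed : forall (xs : nat -> H) (ts : nat -> R) x t,
  (forall n, E (xs n, ts n)) -> xs @ \oo --> x -> ts @ \oo --> t -> E (x, t).
Variable b : R.
Hypothesis E_lb : forall p, E p -> b <= p.2 + `|p.1| ^+ 2 / 2.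

Let f (p : H * R) := p.2 + `|p.1| ^+ 2 / 2.
Let mu := inf (f @` E).

Let f_inf : has_inf (f @` E).
Proof.
case: E_neq0 => p Ep; split; first by exists (f p); exists p.
by exists b => _ [q Eq <-]; exact: E_lb.
Qed.

Let mu_le p : E p -> mu <= f p.
Proof. by move=> Ep; apply: (ge_inf f_inf.2); exists p. Qed.

(* the parallelogram identity at the midpoint of p and q *)
Let gap p q : E p -> E q -> `|p.1 - q.1| ^+ 2 / 8 <= (f p + f q) / 2 - mu.
Proof.
move=> Ep Eq; have := mu_le (E_convex Ep Eq (s := 2^-1) _).
have -> : (0 <= (2^-1 : R) <= 1) = true by apply/andP; split; lra.
move=> /(_ isT); rewrite /f /=.
have -> : p.1 + 2^-1 *: (q.1 - p.1) = 2^-1 *: (p.1 + q.1).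
  by rewrite scalerBr scalerDr addrCA -{1}(scale1r p.1) -scalerBl addrC; congr (_ *: _ + _); lra.
rewrite normrZ exprMn sqr_normB sqr_normD ger0_norm ?invr_ge0//.
by rewrite expr2; lra.
Qed.

(** A minimiser of t + |x|^2 / 2 over a closed convex set of pairs (x, t)
    exists because minimising sequences are Cauchy, by the parallelogram
    identity; the conclusion is its first-order optimality condition. *)
Lemma strongly_convex_min : exists x0 t0, E (x0, t0) /\
  forall x t, E (x, t) -> t0 + `|x0| ^+ 2 <= t + inner x0 x.
Proof.
have ex n : exists p, E p /\ f p < mu + n.+1%:R^-1.
  have n0 : 0 < (n.+1%:R^-1 : R) by rewrite invr_gt0.
  have [_ [p Ep <-] fp] := inf_adherent n0 f_inf.
  by exists p.
have /choice[ps psE] := ex.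
have inv0 : (n.+1%:R^-1 : R) @[n --> \oo] --> 0 by exact: cvg_harmonic.
have fps : f (ps n) @[n --> \oo] --> mu.
  apply: (squeeze_cvgr (f := cst mu) (h := fun n => mu + n.+1%:R^-1)).
  - apply: nearW => n; apply/andP; split; last exact/ltW/(psE n).2.
    exact/mu_le/(psE n).1.
  - exact: cvg_cst.
  - by rewrite -[X in _ --> X]addr0; apply: cvgD => //; exact: cvg_cst.
have cxs : cvg ((ps n).1 @[n --> \oo]).
  apply: cauchy_cvg; apply/cauchy_exP => e e0.
  have e8 : 0 < e ^+ 2 / 8 by rewrite divr_gt0// exprn_gt0.
  have [N _ NE] : \forall n \near \oo, n.+1%:R^-1 < e ^+ 2 / 8.
    by move/cvgr_lt : inv0; exact.
  exists (ps N).1; exists N => // n Nn /=; rewrite -ball_normE /=.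
  rewrite -(@ltr_pXn2r _ 2)// ?nnegrE ?(ltW e0)//.
  have fps_lt k : (N <= k)%N -> f (ps k) < mu + e ^+ 2 / 8.
    by move=> Nk; apply: lt_trans (psE k).2 _; rewrite ltrD2l; exact: NE.
  have := gap (psE N).1 (psE n).1.
  have := fps_lt _ (leqnn N); have := fps_lt _ Nn.
  set q := `|_ - _| ^+ 2; lra.
have /cvg_ex[x0 xs0] := cxs.
have nxs : `|(ps n).1| ^+ 2 / 2 @[n --> \oo] --> `|x0| ^+ 2 / 2.
  apply: cvgMl; apply: (cvg_comp _ (fun r : R => r ^+ 2) (cvg_norm xs0)).
  exact: exprn_continuous.
have ts0 : (ps n).2 @[n --> \oo] --> mu - `|x0| ^+ 2 / 2.
  rewrite (_ : (fun n => (ps n).2) = (fun n => f (ps n) - `|(ps n).1| ^+ 2 / 2)); last first.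
    by apply/funext => n; rewrite /f addrK.
  exact: cvgB.
have E0 : E (x0, mu - `|x0| ^+ 2 / 2).
  apply: (E_closed (xs := fun n => (ps n).1) (ts := fun n => (ps n).2)) => // n.
  by rewrite -surjective_pairing; exact: (psE n).1.
exists x0, (mu - `|x0| ^+ 2 / 2); split=> // x t Ext.
(* first variation along the segment from the minimiser to (x, t) *)
set D := t - (mu - `|x0| ^+ 2 / 2) + inner x0 (x - x0).
have D_ge s : 0 < s <= 1 -> 0 <= D + s * (`|x - x0| ^+ 2 / 2).
  move=> /andP[s0 s1].
  have := mu_le (E_convex E0 Ext (s := s) _); rewrite (ltW s0) s1 => /(_ isT).
  rewrite /f /= sqr_normD innerZr normrZ exprMn ger0_norm ?(ltW s0)// => h.
  rewrite -(pmulr_rge0 _ s0) /D; move: h.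
  rewrite expr2; lra.
have D0 : 0 <= D.
  rewrite leNgt; apply/negP => Dlt.
  set q := `|x - x0| ^+ 2 / 2 in D_ge.
  have q0 : 0 <= q by rewrite divr_ge0// sqr_ge0.
  have q1 : 0 < q + 1 by rewrite ltr_wpDl.
  set s := Num.min 1 (- D / (2 * (q + 1))).
  have s0 : 0 < s by rewrite lt_min ltr01 divr_gt0// ?oppr_gt0// mulr_gt0.
  have := D_ge s; rewrite s0 ge_min lexx => /(_ isT).
  suff : s * q < - D by lra.
  apply: (@le_lt_trans _ _ (- D / (2 * (q + 1)) * (q + 1))).
    apply: ler_pM => //; first exact: ltW.
      by rewrite ge_min lexx orbT.
    by rewrite lerDl.
  rewrite invfM mulrA mulfVK ?gt_eqF//; lra.
move: D0; rewrite /D innerDr innerNr inner_normE; lra.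
Qed.

End strongly_convex_minimisation.

(** * Riesz representation and Minty's theorem *)

Section riesz.
Context {R : realType} {H : hilbertType R}.

(** Minimising |x|^2 / 2 - l x: the optimality condition says exactly that the
    minimiser represents l. *)
Lemma riesz_representation (l : H -> R) (M : R) :
  (forall x y, l (x + y) = l x + l y) ->
  (forall (k : R) x, l (k *: x) = k * l x) ->
  (forall x, `|l x| <= M * `|x|) ->
  exists p, forall x, l x = inner p x.
Proof.
move=> lD lZ lM.
have lN x : l (- x) = - l x by rewrite -scaleN1r lZ mulN1r.
pose E : set (H * R) := [set p | - l p.1 <= p.2].
have [||||x0 [t0 [E0 h]]] := @strongly_convex_min R H E _ _ _ (- (M ^+ 2 / 2)).
- by exists (0, - l 0); rewrite /E /=.
- move=> [x t] [y r] s; rewrite /E /= => xt yr /andP[s0 s1].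
  rewrite lD lZ lD lN.
  have := ler_wpM2l s0 yr; have : 0 <= 1 - s by lra.
  move=> s2; have := ler_wpM2l s2 xt; lra.
- move=> xs ts x t Ext xsx tst; rewrite /E /=.
  have lxs : - l (xs n) @[n --> \oo] --> - l x.
    apply: cvgN; apply/subr_cvg0.
    apply: (@norm_le_cvg0 _ _ _ _ _ _ (fun n => M * `|xs n - x|)).
      by move=> n; rewrite -lN -lD.
    by rewrite -(mulr0 M); apply: cvgMr; apply/norm_cvg0P/subr_cvg0.
  by apply: (ler_cvg_to lxs tst); apply: nearW => n; exact: Ext.
- move=> [x t]; rewrite /E /= => xt.
  have := lM x; rewrite ler_norml => /andP[_ lx].
  have := sqr_ge0 (`|x| - M); rewrite sqrrB; lra.
have key y : 0 <= inner x0 y - l y.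
  have := h (x0 + y) (- l (x0 + y)); rewrite /E /= lexx => /(_ isT).
  rewrite lD innerDr inner_normE; move: E0; rewrite /E /=; lra.
exists x0 => x; have := key x; have := key (- x).
rewrite innerNr lN; lra.
Qed.

End riesz.

Lemma hsum_innerE (R : realType) (m : nat) (H : 'I_m -> hilbertType R)
  (x y : hsum H) : inner x y = \sum_i inner (x i) (y i).
Proof. by []. Qed.

Lemma hsum_sqnormE (R : realType) (m : nat) (H : 'I_m -> hilbertType R)
  (x : hsum H) : `|x| ^+ 2 = \sum_i `|x i| ^+ 2.
Proof. by rewrite -inner_normE; apply: eq_bigr => i _; rewrite inner_normE. Qed.

Section minty.
Context {R : realType} {H : hilbertType R} (A : H -> set H).
Hypothesis A_mono : forall x u y v, A x u -> A y v -> 0 <= inner (x - y) (u - v).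
Hypothesis A_max : forall x u,
  (forall y v, A y v -> 0 <= inner (x - y) (u - v)) -> A x u.

Let HH := hsum (fun _ : 'I_2 => H).
Let pr (x u : H) : HH := fun i => if i == ord0 then x else u.
Let sn (p : HH) : H := p (lift ord0 ord0).

Let inner_pr x u (p : HH) : inner (pr x u) p = inner x (p ord0) + inner u (sn p).
Proof. by rewrite hsum_innerE !big_ord_recl big_ord0 addr0. Qed.

Let norm_pr (p : HH) : `|p| ^+ 2 = `|p ord0| ^+ 2 + `|sn p| ^+ 2.
Proof. by rewrite hsum_sqnormE !big_ord_recl big_ord0 addr0. Qed.

(* the epigraph of the Fitzpatrick function of A *)
Let E : set (HH * R) := [set p | forall y v, A y v ->
  inner (pr v y) p.1 - inner y v <= p.2].

Let fitzpatrick_ge p t : E (p, t) -> inner (p ord0) (sn p) <= t.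
Proof.
move=> Ept; rewrite leNgt; apply/negP => tlt.
have gap y v : A y v -> 0 < inner (p ord0 - y) (sn p - v).
  move=> Ayv; have := Ept y v Ayv; rewrite /= inner_pr !innerE (innerC v).
  move: tlt; rewrite -/(sn p); lra.
have Ap : A (p ord0) (sn p) by apply: A_max => y v Ayv; exact/ltW/gap.
by have := gap _ _ Ap; rewrite subrr inner0l ltxx.
Qed.

(** Minty's theorem at 0, after Simons and Zalinescu: the Fitzpatrick function
    of A dominates the pairing, so adding half the squared norm of the pair
    makes it bounded below, and its minimiser gives a zero of Id + A. *)
Lemma minty0 : exists x, A x (- x).
Proof.
have EA y v : A y v -> E (pr y v, inner y v).
  move=> Ayv z w Azw; have := A_mono Ayv Azw.
  by rewrite /= inner_pr /= /sn /pr /= !innerE (innerC w); lra.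
have [||||p [t [Ept h]]] := @strongly_convex_min R _ E _ _ _ 0.
- apply: contrapT => E0.
  have A0 x u : ~ A x u by move=> Axu; apply: E0; exists (pr x u, inner x u); exact: EA.
  by apply: (A0 0 0); apply: A_max => y v /A0.
- move=> [x t] [y r] s; rewrite /E /= => xt yr /andP[s0 s1] z w Azw.
  rewrite innerDr innerZr innerDr innerNr.
  have := ler_wpM2l s0 (yr _ _ Azw); have : 0 <= 1 - s by lra.
  move=> s2; have := ler_wpM2l s2 (xt _ _ Azw); rewrite /=; lra.
- move=> xs ts x t Ext xsx tst z w Azw /=.
  have lxs : inner (pr w z) (xs n) - inner z w @[n --> \oo] -->
      inner (pr w z) x - inner z w.
    by apply: cvgB; [exact: inner_cvgr|exact: cvg_cst].
  by apply: (ler_cvg_to lxs tst); apply: nearW => n; exact: Ext.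
- move=> [p t] Ept; have := fitzpatrick_ge Ept => /= h.
  have := sqr_ge0 `|p ord0 + sn p|; rewrite sqr_normD norm_pr; lra.
set x0 := p ord0; set u0 := sn p.
have key y v : A y v -> `|x0 + u0| ^+ 2 <= inner (- u0 - y) (- x0 - v).
  move=> Ayv; have := h _ _ (EA _ _ Ayv); have := fitzpatrick_ge Ept.
  rewrite (innerC p) inner_pr norm_pr sqr_normD !innerE -/x0 -/u0.
  rewrite (innerC u0 x0) (innerC u0 v); lra.
have A0 : A (- u0) (- x0).
  by apply: A_max => y v /key; apply: le_trans; exact: sqr_ge0.
have := key _ _ A0; rewrite subrr inner0l => xu.
have /eqP : `|x0 + u0| ^+ 2 = 0 by apply/eqP; rewrite eq_le xu sqr_ge0.
rewrite sqrf_eq0 normr_eq0 addr_eq0 => /eqP x0u0.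
by exists x0; rewrite {1}x0u0.
Qed.

End minty.

(** * Resolvents of maximally monotone operators *)

Section resolvent.
Context {R : realType} {H : hilbertType R} (A : H -> set H).
Hypothesis A_maxmon : maximally_monotone A.

Lemma maxmon_mono x u y v : A x u -> A y v -> 0 <= inner (x - y) (u - v).
Proof. by move=> Axu Ayv; exact: A_maxmon.1 Axu Ayv. Qed.

Lemma maxmon_max x u :
  (forall y v, A y v -> 0 <= inner (x - y) (u - v)) -> A x u.
Proof.
move=> xu; pose A' y := A y `|` [set v | y = x /\ v = u].
have mono' : Defs.monotone A'.
  move=> y v z w; rewrite /gra /A' /= => -[Ayv|[-> ->]] [Azw|[-> ->]].
  - exact: maxmon_mono.
  - by rewrite -opprB innerNl -(opprB u) innerNr opprK; exact: xu.
  - exact: xu.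
  - by rewrite subrr inner0l.
have sub : gra A `<=` gra A' by move=> [y v]; left.
have : gra A (x, u) by rewrite -(A_maxmon.2 A' mono' sub); right.
by [].
Qed.

(** [minty0] for the maximally monotone operator x |-> g A x - y. *)
Lemma minty (g : R) (y : H) : 0 < g -> exists x, A x (g^-1 *: (y - x)).
Proof.
move=> g0; pose A' (x : H) : set H := [set u | A x (g^-1 *: (y + u))].
apply: (@minty0 _ _ A').
- move=> x u z v Axu Azv; have := maxmon_mono Axu Azv.
  rewrite -scalerBr opprD addrACA subrr add0r innerZr pmulr_rge0 ?invr_gt0//.
- move=> x u h; apply: maxmon_max => z v Azv.
  have := h z (g *: v - y); rewrite /A' /= addrC subrK scalerA mulVf ?gt_eqF// scale1r.
  move=> /(_ Azv).
  have -> : u - (g *: v - y) = g *: (g^-1 *: (y + u) - v).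
    by rewrite scalerBr scalerA divff ?gt_eqF// scale1r opprB addrCA addrA.
  by rewrite innerZr pmulr_rge0.
Qed.

Lemma resolventP (g : R) (y : H) : 0 < g ->
  A (resolvent (op_scale g A) y) (g^-1 *: (y - resolvent (op_scale g A) y)).
Proof.
move=> g0; set J := resolvent _ _.
have : op_inv (op_id_add (op_scale g A)) y J.
  have [x Ax] := minty y g0.
  apply: (@xgetPex _ 0 (op_inv (op_id_add (op_scale g A)) y)).
  exists x; rewrite /op_inv /= /op_id_add /=; exists (y - x); last by rewrite addrC subrK.
  by eexists; [exact: Ax|rewrite scalerA divff ?gt_eqF// scale1r].
case=> _ [u Au <-] <-.
by rewrite addrC addKr scalerA mulVf ?gt_eqF// scale1r.
Qed.

(** Firm nonexpansiveness of resolvents, phrased on the graph so that it also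
    identifies the resolvent once a solution of its inclusion is known. *)
Lemma maxmon_firm (g : R) x y p q : 0 < g ->
  A p (g^-1 *: (x - p)) -> A q (g^-1 *: (y - q)) ->
  `|p - q| ^+ 2 + `|(x - p) - (y - q)| ^+ 2 <= `|x - y| ^+ 2.
Proof.
move=> g0 Ap Aq; have := maxmon_mono Ap Aq.
rewrite -scalerBr innerZr pmulr_rge0 ?invr_gt0// => h.
have -> : x - y = (p - q) + ((x - p) - (y - q)).
  have -> : x - p - (y - q) = x - y - (p - q) by rewrite !opprD !opprK addrACA.
  by rewrite [RHS]addrC subrK.
rewrite [leRHS]sqr_normD; lra.
Qed.

Lemma resolvent_firm (g : R) x y : 0 < g ->
  let J := resolvent (op_scale g A) in
  `|J x - J y| ^+ 2 + `|(x - J x) - (y - J y)| ^+ 2 <= `|x - y| ^+ 2.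
Proof. by move=> g0 /=; apply: (maxmon_firm g0); exact: resolventP. Qed.

Lemma resolvent_lip (g : R) x y : 0 < g ->
  `|resolvent (op_scale g A) x - resolvent (op_scale g A) y| <= `|x - y|.
Proof.
move=> g0; rewrite -(@ler_pXn2r _ 2)// ?nnegrE//.
by apply: le_trans (resolvent_firm x y g0); rewrite lerDl sqr_ge0.
Qed.

Lemma resolvent_eq (g : R) x p : 0 < g -> A p (g^-1 *: (x - p)) ->
  resolvent (op_scale g A) x = p.
Proof.
move=> g0 Ap; have := maxmon_firm g0 (resolventP x g0) Ap.
rewrite subrr normr0 expr0n/= => h; apply/eqP; rewrite -subr_eq0 -normr_eq0.
rewrite -sqrf_eq0 eq_le sqr_ge0 andbT; apply: le_trans h.
by rewrite lerDl sqr_ge0.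
Qed.

(** Monotonicity inequalities survive a weak limit of the points paired with a
    strong limit of the values, and maximality then puts the limit pair in the
    graph. *)
Lemma maxmon_demiclosed (I : Type) (F : set_system I) (FF : ProperFilter F)
    (f g : I -> H) (M : R) (p v : H) :
  (forall i, A (f i) (g i)) -> (forall i, `|f i| <= M) ->
  (forall y, inner (f i) y @[i --> F] --> inner p y) -> g @ F --> v -> A p v.
Proof.
move=> Afg fM fp gv; apply: maxmon_max => y w Ayw.
have fgw : inner (f i) (g i - w) @[i --> F] --> inner p (v - w).
  by apply: (inner_cvg_bounded fM (fp _)); apply: cvgB => //; exact: cvg_cst.
have ygw : inner y (g i - w) @[i --> F] --> inner y (v - w).
  by apply: inner_cvgr; apply: cvgB => //; exact: cvg_cst.
rewrite innerDl innerNl.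
have cvg_gap : inner (f i) (g i - w) - inner y (g i - w) @[i --> F] -->
    inner p (v - w) - inner y (v - w) by exact: cvgB.
rewrite -(cvg_lim (@Rhausdorff R) cvg_gap); apply: limr_ge.
  by apply/cvg_ex; eexists; exact: cvg_gap.
apply: nearW => i.
by rewrite -innerNl -innerDl; exact: maxmon_mono.
Qed.

End resolvent.

(** * Weak limits along ultrafilters *)

Section weak_limits.
Context {R : realType} {H : hilbertType R}.

Lemma ultra_fmap (S T : Type) (f : S -> T) (U : set_system S) :
  UltraFilter U -> UltraFilter (f @ U).
Proof.
move=> UU; split=> [|G GG fUG]; first exact: fmap_proper_filter.
apply/seteqP; split=> [B GB|]; last exact: fUG.
have [//|UB] := in_ultra_setVsetC (f @^-1` B) UU.
have /filter_ex[y []//] : G (B `&` ~` B) by apply: filterI => //; exact: fUG.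
Qed.

(** Along an ultrafilter every bounded sequence converges weakly: the scalar
    limits exist by compactness of segments, and Riesz gives the vector.  This
    replaces the extraction of weakly convergent subsequences. *)
Lemma weak_ultralimit (U : set_system nat) (UU : UltraFilter U)
    (f : nat -> H) (M : R) : (forall n, `|f n| <= M) ->
  exists p, forall y, inner (f n) y @[n --> U] --> inner p y.
Proof.
move=> fM.
have cv y : cvg (inner (f n) y @[n --> U]).
  have := @segment_compact R (- (M * `|y|)) (M * `|y|).
  rewrite compact_ultra => /(_ _ (ultra_fmap (fun n => inner (f n) y) UU)) [].
    apply: nearW => n /=; rewrite in_itv /= -ler_norml.
    by apply: le_trans (cauchy_schwarz _ _) _; exact: ler_wpM2r.
  by move=> l [_ fl]; apply/cvg_ex; exists l.
pose l y := lim (inner (f n) y @[n --> U]).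
have ly y : inner (f n) y @[n --> U] --> l y by exact: cv.
have [||y|p lp] := @riesz_representation R H l M; last first.
- by exists p => y; rewrite -lp.
- have lyn : `|inner (f n) y| @[n --> U] --> `|l y| by exact: cvg_norm.
  rewrite -(cvg_lim (@Rhausdorff R) lyn); apply: limr_le.
    by apply/cvg_ex; eexists; exact: lyn.
  apply: nearW => n; apply: le_trans (cauchy_schwarz _ _) _; exact: ler_wpM2r.
- move=> k x; apply: (cvg_lim (@Rhausdorff R)).
  by under eq_fun do rewrite innerZr; apply: cvgMr.
- move=> x y; apply: (cvg_lim (@Rhausdorff R)).
  by under eq_fun do rewrite innerDr; apply: cvgD.
Qed.

(** Opial's lemma for the norm of D x, where D' stands for the adjoint of D
    composed with D.  Two weak limits p and q along ultrafilters coincide: the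
    difference of the squared distances to p and q is affine in the sequence
    and converges, so its two limits agree, which is the norm of D (p - q)
    being 0. *)
Lemma opial (D D' : H -> H) (k : R) (S : set H) (xs : nat -> H) :
  (forall x y, D (x - y) = D x - D y) ->
  (forall x y, inner (D x) (D y) = inner x (D' y)) ->
  0 <= k -> (forall x, `|x| <= k * `|D x|) ->
  S !=set0 ->
  (forall z, S z -> cvg (`|D (xs n - z)| @[n --> \oo])) ->
  (forall (U : set_system nat) p, UltraFilter U -> \oo `<=` U ->
    (forall y, inner (xs n) y @[n --> U] --> inner p y) -> S p) ->
  exists2 p, S p & weak_cvg xs p.
Proof.
move=> DB DD' k0 Dk [z0 Sz0] Scvg Sclus.
have [M xsM] : exists M, forall n, `|xs n| <= M.
  have [M [_ hM]] := cvg_seq_bounded (Scvg _ Sz0).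
  exists (k * (M + 1) + `|z0|) => n; rewrite -lerBlDr.
  apply: (le_trans (lerB_dist _ _)); apply: (le_trans (Dk _)).
  apply: ler_wpM2l => //; have Ms : M < M + 1 by rewrite ltrDl.
  by have := hM _ Ms n I; rewrite /= normr_id.
have ultra_limit_unique U V p q : UltraFilter U -> UltraFilter V ->
    \oo `<=` U -> \oo `<=` V ->
    (forall y, inner (xs n) y @[n --> U] --> inner p y) ->
    (forall y, inner (xs n) y @[n --> V] --> inner q y) -> p = q.
  move=> UU UV oU oV xsp xsq.
  have Sp := Sclus _ _ UU oU xsp; have Sq := Sclus _ _ UV oV xsq.
  pose c := `|D p| ^+ 2 - `|D q| ^+ 2.
  pose phi n := `|D (xs n - p)| ^+ 2 - `|D (xs n - q)| ^+ 2.
  have phiE n : phi n = - 2 * inner (xs n) (D' (p - q)) + c.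
    by rewrite /phi /c -DD' !DB !sqr_normB innerDr innerNr; ring.
  have [L phiL] : exists L : R, phi n @[n --> \oo] --> L.
    apply/cvg_ex; apply: is_cvgB; apply/cvg_ex.
      have /cvg_ex[a ha] := Scvg _ Sp; exists (a ^+ 2).
      by apply: (cvg_comp _ (fun r : R => r ^+ 2) ha); exact: exprn_continuous.
    have /cvg_ex[a ha] := Scvg _ Sq; exists (a ^+ 2).
    by apply: (cvg_comp _ (fun r : R => r ^+ 2) ha); exact: exprn_continuous.
  have phi_lim W r : UltraFilter W -> \oo `<=` W ->
      (forall y, inner (xs n) y @[n --> W] --> inner r y) ->
      L = - 2 * inner r (D' (p - q)) + c.
    move=> UW oW xsr.
    have h1 : phi @ W --> L by move=> A /phiL; exact: oW.
    have h2 : phi @ W --> - 2 * inner r (D' (p - q)) + c.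
      rewrite (_ : phi = fun n => - 2 * inner (xs n) (D' (p - q)) + c); last first.
        by apply/funext => n; exact: phiE.
      apply: cvgD; last exact: cvg_cst.
      by apply: cvgMr; exact: xsr.
    by rewrite -(cvg_lim (@Rhausdorff R) h1) (cvg_lim (@Rhausdorff R) h2).
  have := phi_lim _ _ UU oU xsp; rewrite (phi_lim _ _ UV oV xsq) => pq.
  have /eqP : `|D (p - q)| ^+ 2 = 0.
    by rewrite -inner_normE DD' innerDl innerNl; lra.
  rewrite sqrf_eq0 => /eqP Dpq; apply/eqP; rewrite -subr_eq0 -normr_le0.
  by apply: le_trans (Dk _) _; rewrite Dpq mulr0.
have [U [UU oU]] := @ultraFilterLemma nat \oo _.
have [p xsp] := weak_ultralimit UU xsM.
exists p; first exact: Sclus xsp.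
move=> y; apply/cvgrPdist_lt => e e0; apply: contrapT => notnear.
(* the indices that stay away from the limit carry an ultrafilter of their own *)
pose far : set nat := [set n | ~ `|inner p y - inner (xs n) y| < e].
have PF : ProperFilter (within far \oo).
  split; last exact: within_filter.
  move=> /= h; apply: notnear; near=> n; apply: contrapT.
  by near: n; exact: h.
have [V [UV oV]] := ultraFilterLemma PF.
have ooV : \oo `<=` V.
  move=> A oA; apply: oV; rewrite /within /=; near=> n; move=> _.
  by near: n; exact: oA.
have Vfar : V far by apply: oV; rewrite /within /=; apply: nearW.
have [q xsq] := weak_ultralimit UV xsM.
have pq := ultra_limit_unique _ _ _ _ UU UV oU ooV xsp xsq.
have := xsq y; rewrite -pq => /cvgrPdist_lt /(_ _ e0) near_lt.
have [n [/= lt_e]] := filter_ex (filterI (near_lt : V _) Vfar); exact.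
Unshelve. all: by end_near. Qed.

End weak_limits.

(** * Coordinates and weighted norms in the direct sum *)

Section direct_sum_tools.
Context {R : realType} {m : nat} {H : 'I_m -> hilbertType R}.

Definition hsum_inj (i : 'I_m) (y : H i) : hsum H := dfwith (0 : hsum H) i y.

Lemma inner_hsum_inj (x : hsum H) i (y : H i) :
  inner x (hsum_inj y) = inner (x i) y.
Proof.
rewrite hsum_innerE (bigD1 i)//= big1 ?addr0; first by rewrite /hsum_inj dfwithin.
by move=> j ji; rewrite /hsum_inj dfwithout 1?eq_sym// inner0r.
Qed.

Lemma hsum_cvgP (I : Type) (F : set_system I) {FF : Filter F}
    (f : I -> hsum H) (p : hsum H) :
  (forall i, f n i @[n --> F] --> p i) -> f @ F --> p.
Proof.
move=> fp; apply/subr_cvg0.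
apply: (@norm_le_cvg0 _ _ _ _ _ _ (fun n => \sum_i `|f n i - p i|)).
  by move=> n; exact: (hsum_norm_le (f n - p)).
rewrite -[X in _ --> X](@big1_eq _ 0 +%R 'I_m (index_enum _) xpredT).
apply: cvg_big => [|i _]; first exact: add_continuous.
 apply/norm_cvg0P/subr_cvg0; exact: fp.
Qed.

Lemma hsum_cvg_coord (I : Type) (F : set_system I) {FF : Filter F}
    (f : I -> hsum H) (p : hsum H) i :
  f @ F --> p -> f n i @[n --> F] --> p i.
Proof.
move=> /subr_cvg0 fp; apply/subr_cvg0.
apply: (@norm_le_cvg0 _ _ _ _ _ _ (fun n => `|f n - p|)).
  by move=> n; exact: (hsum_norm_ge (f n - p) i).
exact/norm_cvg0P.
Qed.

(** The map whose norm is the weighted norm (sum_i w_i |x_i|^2)^(1/2). *)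
Definition wscale (w : 'I_m -> R) (x : hsum H) : hsum H :=
  fun i => Num.sqrt (w i) *: x i.

Lemma wscaleB w x y : wscale w (x - y) = wscale w x - wscale w y.
Proof. by apply/functional_extensionality_dep => i; exact: scalerBr. Qed.

Lemma wscaleD w x y : wscale w (x + y) = wscale w x + wscale w y.
Proof. by apply/functional_extensionality_dep => i; exact: scalerDr. Qed.

Lemma wscale_sqnorm w x : (forall i, 0 <= w i) ->
  `|wscale w x| ^+ 2 = \sum_i w i * `|x i| ^+ 2.
Proof.
move=> w0; rewrite hsum_sqnormE; apply: eq_bigr => i _.
by rewrite normrZ exprMn real_normK ?num_real// sqr_sqrtr.
Qed.

Lemma inner_wscale w x y : (forall i, 0 <= w i) ->
  inner (wscale w x) (wscale w y) =
  inner x ((fun i => w i *: y i) : hsum H).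
Proof.
move=> w0; rewrite !hsum_innerE; apply: eq_bigr => i _.
by rewrite innerZl !innerZr mulrA -expr2 sqr_sqrtr.
Qed.

Lemma wscale_ge w x : (forall i, 1 <= w i) -> `|x| <= `|wscale w x|.
Proof.
move=> w1; rewrite -(@ler_pXn2r _ 2)// ?nnegrE// wscale_sqnorm; last first.
  by move=> i; apply: le_trans (w1 i).
by rewrite hsum_sqnormE; apply: ler_sum => i _; rewrite ler_peMl// sqr_ge0.
Qed.

Lemma wscale_le w x (c : R) : (forall i, 0 <= w i <= c ^+ 2) -> 0 <= c ->
  `|wscale w x| <= c * `|x|.
Proof.
move=> wc c0; rewrite -(@ler_pXn2r _ 2)// ?nnegrE ?mulr_ge0//.
rewrite exprMn wscale_sqnorm => [|i]; last by case/andP: (wc i).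
rewrite hsum_sqnormE mulr_sumr; apply: ler_sum => i _.
by rewrite ler_wpM2r ?sqr_ge0//; case/andP: (wc i).
Qed.

End direct_sum_tools.

(** * The forward-backward map *)

Section forward_backward.
Context {R : realType} {m : nat} {H : 'I_m -> hilbertType R}.
Context (A : forall i, H i -> set (H i)) (B : forall i, hsum H -> H i).
Arguments A : clear implicits.
Arguments B : clear implicits.
Hypothesis A_maxmon : forall i, maximally_monotone (A i).
Context (theta : R).
Hypothesis theta_gt0 : 0 < theta.
Hypothesis B_cocoercive : forall x y : hsum H,
  theta * (\sum_i `|B i x - B i y| ^+ 2) <=
    \sum_i inner (x i - y i) (B i x - B i y).

Definition fwd (x : hsum H) : hsum H := fun i => B i x.

Definition fwd_bwd (g : R) (x : hsum H) : hsum H :=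
  fun i => resolvent (op_scale g (A i)) (x i - g *: B i x).

Lemma fwd_cocoercive x y :
  theta * `|fwd x - fwd y| ^+ 2 <= inner (x - y) (fwd x - fwd y).
Proof. by rewrite hsum_sqnormE; exact: B_cocoercive. Qed.

Lemma fwd_lip x y : `|fwd x - fwd y| <= theta^-1 * `|x - y|.
Proof.
rewrite ler_pdivlMl//.
have [->|n0] := eqVneq `|fwd x - fwd y| 0; first by rewrite mulr0.
rewrite -(@ler_pM2r _ `|fwd x - fwd y|) ?lt_def ?n0//= -mulrA -expr2.
exact: le_trans (fwd_cocoercive x y) (inner_le _ _).
Qed.

Lemma inclusion_solutionsP z : inclusion_solutions A B z <-> forall i, A i (z i) (- fwd z i).
Proof.
split=> [zS i|zS i].
  by have [u Au /eqP] := zS i; rewrite addr_eq0 => /eqP <-.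
by exists (- fwd z i) => //; rewrite addNr.
Qed.

Lemma fwd_bwd_sol g z : 0 < g -> inclusion_solutions A B z -> fwd_bwd g z = z.
Proof.
move=> g0 /inclusion_solutionsP zS; apply/functional_extensionality_dep => i.
apply: resolvent_eq => //.
rewrite addrAC subrr add0r scalerN scalerA mulVf ?gt_eqF// scale1r; exact: zS.
Qed.

(** Firm nonexpansiveness of the resolvents, summed over the coordinates, and
    cocoercivity of the forward operator applied to the squared norm of the
    forward step. *)
Lemma fwd_bwd_ineq g x z : 0 < g -> inclusion_solutions A B z ->
  `|fwd_bwd g x - z| ^+ 2 <= `|x - z| ^+ 2
    - g * (2 * theta - g) * `|fwd x - fwd z| ^+ 2
    - `|x - fwd_bwd g x - g *: (fwd x - fwd z)| ^+ 2.
Proof.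
move=> g0 zS.
have firm : `|fwd_bwd g x - z| ^+ 2
    + `|x - fwd_bwd g x - g *: (fwd x - fwd z)| ^+ 2
    <= `|x - z - g *: (fwd x - fwd z)| ^+ 2.
  rewrite !hsum_sqnormE -big_split; apply: ler_sum => i _ /=.
  have e1 : x i - g *: B i x - fwd_bwd g x i - (z i - g *: B i z - z i) =
      (x - fwd_bwd g x - g *: (fwd x - fwd z)) i.
    rewrite -[RHS]/(x i - fwd_bwd g x i - g *: (B i x - B i z)) scalerBr.
    move: (x i) (g *: _) (g *: _) (fwd_bwd g x i) (z i) => a e b c d'.
    rewrite [d' - e]addrC addrK opprK [in RHS]opprD opprK [RHS]addrA.
    by congr (_ + _); exact: addrAC.
  have e2 : x i - g *: B i x - (z i - g *: B i z) =
      (x - z - g *: (fwd x - fwd z)) i.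
    rewrite -[RHS]/(x i - z i - g *: (B i x - B i z)) scalerBr.
    by rewrite !opprD !opprK addrACA.
  have Jz : resolvent (op_scale g (A i)) (z i - g *: B i z) = z i.
    exact: (congr1 (fun f : hsum H => f i) (fwd_bwd_sol g0 zS)).
  have := resolvent_firm (A_maxmon i) (x i - g *: B i x) (z i - g *: B i z) g0.
  by rewrite /= Jz -e1 -e2.
have := fwd_cocoercive x z; rewrite -(ler_pM2l g0).
move: firm; rewrite [X in _ <= X]sqr_normB innerZr normrZ exprMn.
rewrite real_normK ?num_real// expr2; lra.
Qed.

End forward_backward.

(** * Deterministic convergence *)

Section forward_backward_convergence.
Context {R : realType} {m : nat} {H : 'I_m -> hilbertType R}.
Context (A : forall i, H i -> set (H i)) (B : forall i, hsum H -> H i).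
Arguments A : clear implicits.
Arguments B : clear implicits.
Hypothesis A_maxmon : forall i, maximally_monotone (A i).
Context (theta : R).
Hypothesis theta_gt0 : 0 < theta.
Hypothesis B_cocoercive : forall x y : hsum H,
  theta * (\sum_i `|B i x - B i y| ^+ 2) <=
    \sum_i inner (x i - y i) (B i x - B i y).
Context (gamma : nat -> R) (g0 g1 : R).
Hypothesis g0_gt0 : 0 < g0.
Hypothesis gamma_bnd : forall n, g0 <= gamma n <= g1.

Let gamma_gt0 n : 0 < gamma n.
Proof. by case/andP: (gamma_bnd n) => + _; exact: lt_le_trans. Qed.

Context (xs : nat -> hsum H) (z0 : hsum H).
Hypothesis z0_sol : inclusion_solutions A B z0.
Hypothesis fwd_xs : fwd B (xs n) @[n --> \oo] --> fwd B z0.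
Hypothesis residual0 :
  xs n - fwd_bwd A B (gamma n) (xs n) - gamma n *: (fwd B (xs n) - fwd B z0)
    @[n --> \oo] --> 0.

Let ts n := fwd_bwd A B (gamma n) (xs n).
Let us n : hsum H := (gamma n)^-1 *: (xs n - gamma n *: fwd B (xs n) - ts n).

Let us_A n i : A i (ts n i) (us n i).
Proof. exact: resolventP. Qed.

Let xs_ts : xs n - ts n @[n --> \oo] --> 0.
Proof.
pose r n := xs n - ts n - gamma n *: (fwd B (xs n) - fwd B z0).
apply: (@norm_le_cvg0 _ _ _ _ _ _
  (fun n => `|r n| + g1 * `|fwd B (xs n) - fwd B z0|)).
  move=> n; rewrite -[X in `|X| <= _](subrK (gamma n *: (fwd B (xs n) - fwd B z0))).
  apply: le_trans (ler_normD _ _) _; rewrite lerD2l normrZ.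
  rewrite ler_wpM2r// ger0_norm ?(ltW (gamma_gt0 _))//.
  by case/andP: (gamma_bnd n).
rewrite -[X in _ --> X]addr0 -[X in _ --> _ + X](mulr0 g1).
apply: cvgD; first exact/norm_cvg0P.
apply: cvgMr; exact/norm_cvg0P/subr_cvg0.
Qed.

Let us_lim : us @ \oo --> - fwd B z0.
Proof.
apply/subr_cvg0.
pose r n := xs n - ts n - gamma n *: (fwd B (xs n) - fwd B z0).
apply: (@norm_le_cvg0 _ _ _ _ _ _ (fun n => g0^-1 * `|r n|)).
  move=> n; have -> : us n - - fwd B z0 = (gamma n)^-1 *: r n.
    rewrite opprK -[fwd B z0 in LHS](scalerK (lt0r_neq0 (gamma_gt0 n))) -scalerDr.
    congr (_ *: _); rewrite /r scalerBr [in RHS]opprD opprK [RHS]addrA.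
    by congr (_ + _); exact: addrAC.
  rewrite normrZ ler_wpM2r// ger0_norm ?invr_ge0 ?(ltW (gamma_gt0 _))//.
  by rewrite lef_pV2 ?posrE//; case/andP: (gamma_bnd n).
by rewrite -(mulr0 g0^-1); apply: cvgMr; exact/norm_cvg0P.
Qed.

(** Demiclosedness: the resolvent inclusions pass to the limit because the
    graph of each A_i is weakly-strongly closed, and cocoercivity identifies
    the limit of the forward terms with the forward term at the limit. *)
Let cluster (U : set_system nat) (p : hsum H) : ProperFilter U -> \oo `<=` U ->
  (exists M, forall n, `|xs n| <= M) ->
  (forall y, inner (xs n) y @[n --> U] --> inner p y) ->
  (forall y, inner (ts n) y @[n --> U] --> inner p y) /\
  inclusion_solutions A B p /\ fwd B p = fwd B z0.
Proof.
move=> UU oU [M xsM] xsp.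
have tsp y : inner (ts n) y @[n --> U] --> inner p y.
  rewrite (_ : (fun n => _) = (fun n => inner (xs n) y - inner (xs n - ts n) y)).
    rewrite -[inner p y]subr0; apply: cvgB => //.
    rewrite -(inner0l y); apply: inner_cvgl => V /xs_ts; exact: oU.
  by apply/funext => n; rewrite innerDl innerNl; ring.
have [K xtK] : exists K, forall n, `|xs n - ts n| <= K.
  have [K [_ hK]] := cvg_seq_bounded (cvgP _ xs_ts).
  by exists (K + 1) => n; apply: (hK (K + 1)) => //; rewrite ltrDl.
have tsM n : `|ts n| <= M + K.
  rewrite -[ts n](subKr (xs n)); apply: le_trans (ler_normB _ _) _.
  exact: lerD.
have Ap i : A i (p i) (- fwd B z0 i).
  apply: (@maxmon_demiclosed _ _ _ (A_maxmon i) _ U _ (fun n => ts n i)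
    (fun n => us n i) (M + K)).
  - by move=> n; exact: us_A.
  - by move=> n; apply: le_trans (hsum_norm_ge _ _) (tsM n).
  - move=> y; rewrite -(inner_hsum_inj p y).
    by under eq_fun do rewrite -inner_hsum_inj; exact: tsp.
  - have usi : us n i @[n --> \oo] --> (- fwd B z0) i by exact: hsum_cvg_coord us_lim.
    by move=> V /usi; exact: oU.
have fp : fwd B p = fwd B z0.
  have fxU : fwd B (xs n) - fwd B p @[n --> U] --> fwd B z0 - fwd B p.
    by apply: cvgB; [move=> V /fwd_xs; exact: oU|exact: cvg_cst].
  have h1 : theta * `|fwd B (xs n) - fwd B p| ^+ 2 @[n --> U] -->
      theta * `|fwd B z0 - fwd B p| ^+ 2.
    apply: cvgMr; apply: (cvg_comp _ (fun r : R => r ^+ 2) (cvg_norm fxU)).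
    exact: exprn_continuous.
  have h2 : inner (xs n - p) (fwd B (xs n) - fwd B p) @[n --> U] --> (0 : R).
    apply: (@inner_cvg_bounded _ _ _ U _ _ _ (M + `|p|) _ (fwd B z0 - fwd B p)) => //.
      by move=> n; apply: le_trans (ler_normB _ _) _; rewrite lerD2r.
    rewrite -(subrr (inner p (fwd B z0 - fwd B p))).
    under eq_fun do rewrite innerDl innerNl.
    by apply: cvgB; [exact: xsp|exact: cvg_cst].
  have : theta * `|fwd B z0 - fwd B p| ^+ 2 <= 0.
    apply: (ler_cvg_to h1 h2); apply: nearW => n; exact: fwd_cocoercive.
  rewrite pmulr_rle0// => h; apply/esym/eqP; rewrite -subr_eq0 -normr_eq0.
  by rewrite -sqrf_eq0 eq_le h sqr_ge0.
by split=> //; split=> //; apply/inclusion_solutionsP => i; rewrite fp.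
Qed.

Context (w : 'I_m -> R).
Hypothesis w_ge1 : forall i, 1 <= w i.
Hypothesis fejer : forall z, inclusion_solutions A B z ->
  cvg (`|wscale w (xs n - z)| @[n --> \oo]).

(** The hypothesis [fejer] is what Opial's lemma asks for.  Strong
    convergence applies demiregularity of A_i to the resolvent points ts, whose
    selections us tend to minus the forward term, or demiregularity of the
    forward operator to xs. *)
Lemma fwd_bwd_cvg : exists p, [/\ inclusion_solutions A B p, weak_cvg xs p &
  (forall z i, inclusion_solutions A B z -> demiregular (A i) (z i)) \/
  (forall z, inclusion_solutions A B z ->
    demiregular (fun y : hsum H => [set fwd B y]) z) ->
  xs @ \oo --> p].
Proof.
have w_ge0 i : 0 <= w i by exact: le_trans (w_ge1 i).
have xsM : exists M, forall n, `|xs n| <= M.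
  have [M [_ hM]] := cvg_seq_bounded (fejer z0_sol).
  exists (M + 1 + `|z0|) => n; rewrite -lerBlDr.
  apply: (le_trans (lerB_dist _ _)); apply: (le_trans (wscale_ge _ w_ge1)).
  have Ms : M < M + 1 by rewrite ltrDl.
  by have := hM _ Ms n I; rewrite /= normr_id.
have [||p pS xsp] := @opial _ _ (wscale w)
    (fun y => (fun i => w i *: y i) : hsum H) 1 (inclusion_solutions A B) xs
    (@wscaleB _ _ _ w) (fun x y => inner_wscale x y w_ge0) ler01 _
    (ex_intro _ z0 z0_sol) fejer.
- by move=> x; rewrite mul1r wscale_ge.
- by move=> U p UU oU xsp; have [_ []] := cluster _ oU xsM xsp.
have [tsp [_ fp]] : _ /\ _ /\ _ := @cluster \oo p _ (@subset_refl _ _) xsM xsp.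
exists p; split=> // -[demiA|demiB]; last first.
  have [_ h] := demiB p pS.
  apply: (h xs (fun n => fwd B (xs n)) (fwd B p)) => //.
  by rewrite fp; exact: fwd_xs.
have ts_p : ts @ \oo --> p.
  apply: hsum_cvgP => i; have [_ h] := demiA p i pS.
  apply: (h _ (fun n => us n i) (- fwd B p i)) => //.
  - by move=> n; exact: us_A.
  - by move/inclusion_solutionsP: pS; exact.
  - move=> y; rewrite -(inner_hsum_inj p y).
    by under eq_fun do rewrite -inner_hsum_inj; exact: tsp.
  - have usi : us n i @[n --> \oo] --> (- fwd B z0) i by exact: hsum_cvg_coord us_lim.
    by rewrite fp; exact: usi.
rewrite (_ : xs = fun n => (xs n - ts n) + ts n); last first.
  by apply/funext => n; rewrite subrK.
by rewrite -[p]add0r; apply: cvgD.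
Qed.

End forward_backward_convergence.

(** * Integrals over the events of a sub-sigma-algebra *)

(** Measurability with respect to a sub-sigma-algebra is measurability on the
    same carrier equipped with the smaller structure. *)
Notation sub_measurable G f :=
  (measurable_fun [set: g_sigma_algebraType G] (f : g_sigma_algebraType G -> _)).

Section sub_sigma_algebra.
Local Open Scope ereal_scope.
Context {d : measure_display} {T : measurableType d} {R : realType}.
Context (P : {measure set T -> \bar R}) (G : set (set T)).
Hypothesis subG : <<s G >> `<=` measurable.

Lemma sub_measurable_measurable d' (U : measurableType d') (f : T -> U) :
  sub_measurable G f -> measurable_fun [set: T] f.
Proof. by move=> mf _ B mB; apply: subG; exact: mf. Qed.

Import HBNNSimple.

(** The hypothesis is the case of indicators f; simple functions follow by
    linearity and general f by monotone convergence.  With Y a conditional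
    expectation of X this is the pull-out property; with X an indicator and Y its
    probability it is the factorisation of integrals under independence. *)
Lemma sub_integralM (X Y f : T -> R) :
  measurable_fun setT X -> measurable_fun setT Y ->
  (forall w, 0 <= X w)%R -> (forall w, 0 <= Y w)%R ->
  (forall A, <<s G >> A ->
    \int[P]_(w in A) (X w)%:E = \int[P]_(w in A) (Y w)%:E) ->
  sub_measurable G f -> (forall w, 0 <= f w)%R ->
  forall A, <<s G >> A ->
  \int[P]_(w in A) (f w * X w)%:E = \int[P]_(w in A) (f w * Y w)%:E.
Proof.
move=> mX mY X0 Y0 XY mf f0 A GA.
have mA : measurable A := subG GA.
have mf' : measurable_fun [set: g_sigma_algebraType G] (EFin \o f).
  exact/measurable_EFinP.
pose h := nnsfun_approx (measurableT : measurable [set: g_sigma_algebraType G]) mf'.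
have mh n : measurable_fun [set: T] (h n : T -> R).
  by apply: sub_measurable_measurable; exact: measurable_funP.
have mhy n y : <<s G >> (h n @^-1` [set y]).
  have : measurable (h n @^-1` [set y] : set (g_sigma_algebraType G)).
    exact: measurable_sfunP.
  by [].
suff simple (Z : T -> R) : measurable_fun setT Z -> (forall w, 0 <= Z w)%R ->
    (\int[P]_(w in A) (f w * Z w)%:E =
      lim (\int[P]_(w in A) (h n w * Z w)%:E @[n --> \oo]))
    /\ forall n, \int[P]_(w in A) (h n w * Z w)%:E =
      \sum_(y \in range (h n)) (y%:E * \int[P]_(w in A `&` (h n @^-1` [set y])) (Z w)%:E).
  have [-> hX] := simple X mX X0; have [-> hY] := simple Y mY Y0.
  congr (lim (_ @ \oo)); apply/funext => n; rewrite hX hY.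
  apply: eq_fsbigr => y _; congr (_ * _); apply: XY.
  have : measurable (A `&` (h n @^-1` [set y]) : set (g_sigma_algebraType G)).
    by apply: measurableI; [exact: GA|exact: mhy].
  by [].
move=> mZ Z0; split.
  have fZ w : (f w * Z w)%:E = lim ((h n w * Z w)%:E @[n --> \oo]).
    apply/esym/cvg_lim => //; under eq_fun do rewrite EFinM.
    rewrite EFinM; apply: cvgeZr => //.
    by apply: cvg_nnsfun_approx => // ? _; rewrite lee_fin.
  under eq_integral => w _ do rewrite fZ.
  apply: monotone_convergence => //.
  - move=> n; apply/measurable_EFinP; apply: measurable_funM; exact: measurable_funTS.
  - by move=> n w _; rewrite lee_fin mulr_ge0.
  - move=> w _ k n kn; rewrite lee_fin ler_wpM2r//.
    by have /lefP := nd_nnsfun_approx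
      (measurableT : measurable [set: g_sigma_algebraType G]) mf' kn; exact.
move=> n.
have ge0 y w : (0 <= y * \1_(h n @^-1` [set y]) w)%R.
  by have := nnfun_muleindic_ge0 (h n) y w; rewrite -EFinM lee_fin.
transitivity (\int[P]_(w in A) \sum_(y \in range (h n))
    (y * \1_(h n @^-1` [set y]) w * Z w)%:E).
  apply: eq_integral => w _; rewrite fsumEFin//; congr EFin.
  by rewrite {1}(fimfunE (h n) w) !fsbig_finite//= mulr_suml.
rewrite ge0_integral_fsum//.
- apply: eq_fsbigr => y; rewrite inE => -[w _ wy].
  rewrite integral_mkcondr -ge0_integralZl//.
  + apply: eq_integral => t _; rewrite -mulrA EFinM; congr (_ * _).
    by rewrite epatch_indic /= EFinM muleC.
  + apply/(measurable_restrict (EFin \o Z) (subG (mhy n y)) mA).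
    exact/measurable_funTS/measurable_EFinP.
  + by move=> t _; apply: erestrict_ge0 => u _; rewrite lee_fin.
  + by rewrite lee_fin -wy.
- move=> y; apply/measurable_EFinP; apply: measurable_funM; last exact: measurable_funTS.
  apply: measurable_funM; first exact: measurable_cst.
  by apply: measurable_indic; apply: subG.
- by move=> y t _; rewrite lee_fin mulr_ge0.
Qed.

(** Conditional Jensen inequality for the square root, up to an arbitrary r > 0:
    by the arithmetic-geometric inequality a <= a^2 / (2 s) + s / 2, where
    s = sqrt e + r is measurable for the sub-sigma-algebra and bounded away
    from 0, so that the pull-out property applies to 1 / (2 s). *)
Lemma cond_jensen_sqrt (a e : T -> R) (r : R) :
  measurable_fun setT a -> (forall w, 0 <= a w)%R ->
  sub_measurable G e -> (forall w, 0 <= e w)%R ->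
  (forall A, <<s G >> A ->
    \int[P]_(w in A) (a w ^+ 2)%:E = \int[P]_(w in A) (e w)%:E) ->
  (0 < r)%R -> forall A, <<s G >> A ->
  \int[P]_(w in A) (a w)%:E <= \int[P]_(w in A) (Num.sqrt (e w) + r)%:E.
Proof.
move=> ma a0 me e0 ae r0 A GA; have mA : measurable A := subG GA.
pose s w : R := (Num.sqrt (e w) + r)%R.
have s0 w : (0 < s w)%R by rewrite ltr_wpDl// sqrtr_ge0.
pose phi (t : R) : R := (2 * (Num.sqrt t + r))^-1%R.
have cphi : continuous phi.
  move=> t; apply: cvgV.
    by rewrite mulf_neq0// gt_eqF// ltr_wpDl// sqrtr_ge0.
  apply: cvgMr; apply: cvgD; last exact: cvg_cst.
  exact: sqrt_continuous.
pose f w : R := phi (e w).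
have f0 w : (0 <= f w)%R by rewrite invr_ge0 mulr_ge0// ltW//; exact: s0.
have mf : sub_measurable G f.
  by apply: measurableT_comp me; exact: continuous_measurable_fun.
have mT (g : T -> R) : sub_measurable G g -> measurable_fun [set: T] g.
  exact: sub_measurable_measurable.
have ms2 : measurable_fun [set: T] (fun w => s w / 2)%R.
  apply: measurable_funM; last exact: measurable_cst.
  apply: measurable_funD; last exact: measurable_cst.
  apply: measurableT_comp (mT _ me).
  by apply: continuous_measurable_fun; exact: sqrt_continuous.
have ma2 : measurable_fun [set: T] (fun w => a w ^+ 2)%R by exact: measurable_funX.
have E g : measurable_fun [set: T] g -> measurable_fun A (fun w => (g w : R)%:E).
  by move=> mg; exact/measurable_funTS/measurable_EFinP.
apply: (@le_trans _ _ (\int[P]_(w in A) ((f w * a w ^+ 2)%:E + (s w / 2)%:E))).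
  apply: ge0_le_integral => //.
  - by move=> w _; rewrite lee_fin.
  - exact: E.
  - apply: emeasurable_funD; apply: E => //.
    by apply: measurable_funM => //; exact: mT.
  - move=> w _; rewrite -EFinD lee_fin.
    have : (0 <= (2 * s w)^-1 * (a w - s w) ^+ 2)%R.
      by rewrite mulr_ge0 ?sqr_ge0// f0.
    rewrite (_ : (2 * s w)^-1 * (a w - s w) ^+ 2 =
      f w * a w ^+ 2 - a w + s w / 2)%R; first by lra.
    rewrite /f /phi -/(s w); field; exact: lt0r_neq0.
rewrite ge0_integralD//; first last.
- exact: E.
- by move=> w _; rewrite lee_fin divr_ge0// ltW.
- by apply: E; apply: measurable_funM => //; exact: mT.
- by move=> w _; rewrite lee_fin mulr_ge0// sqr_ge0.
rewrite (@sub_integralM (fun w => a w ^+ 2)%R e f)//; first last.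
- by move=> w; exact: sqr_ge0.
- exact: mT.
rewrite -ge0_integralD//; first last.
- exact: E.
- by move=> w _; rewrite lee_fin divr_ge0// ltW.
- by apply: E; apply: measurable_funM => //; exact: mT.
- by move=> w _; rewrite lee_fin mulr_ge0.
apply: ge0_le_integral => //.
- by move=> w _; rewrite -EFinD lee_fin addr_ge0// ?mulr_ge0// ltW.
- apply: emeasurable_funD; apply: E => //.
  by apply: measurable_funM => //; exact: mT.
- apply: E; rewrite (_ : (fun w => _) = (fun w => 2 * (s w / 2)))%R.
    by apply: measurable_funM.
  by apply/funext => w; rewrite /s; lra.
- move=> w _; rewrite -EFinD lee_fin -/(s w).
  have es : (e w <= s w ^+ 2)%R.
    rewrite -(sqr_sqrtr (e0 w)) ler_pXn2r// ?nnegrE ?sqrtr_ge0 ?(ltW (s0 w))//.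
    by rewrite lerDl ltW.
  suff : (f w * e w <= s w / 2)%R by lra.
  rewrite /f /phi -/(s w) ler_pdivrMl ?mulr_gt0//.
  move: es; rewrite expr2; lra.
Qed.

End sub_sigma_algebra.

(** * Upcrossings *)

Section upcrossings.
Context {R : realType} (a b : R).
Implicit Type f : nat -> R.

(** State of the upcrossing counter of the interval from a to b after time n:
    whether an upcrossing is in progress, and how many have been completed. *)
Fixpoint upcross (f : nat -> R) (n : nat) : bool * nat :=
  if n is n'.+1 then
    let: (s, N) := upcross f n' in
    if s then (f n < b, (N + (b <= f n)%R)%N) else (f n <= a, N)
  else (f 0%N <= a, 0%N).

Definition frequently_le f (M : R) := forall n, exists2 k, (n <= k)%N & f k <= M.
Definition frequently_ge f (M : R) := forall n, exists2 k, (n <= k)%N & M <= f k.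

Lemma upcross_nondecreasing f :
  {homo (fun n => (upcross f n).2) : n k / (n <= k)%N}.
Proof.
apply: homo_leq => [//|? ? ?|n /=]; first exact: leq_trans.
by case: (upcross f n) => -[] N //=; exact: leq_addr.
Qed.

Lemma upcross_unbounded f : frequently_le f a -> frequently_ge f b ->
  forall N, exists n, (N <= (upcross f n).2)%N.
Proof.
move=> fa fb.
have start n : exists2 k, (n <= k)%N & (upcross f k).1.
  apply: contrapT => none.
  have inactive k : (n <= k)%N -> (upcross f k).1 = false.
    by move=> nk; apply/negP => sk; apply: none; exists k.
  have [[//|k] nk fk] := fa n.+1.
  have := inactive k nk; have := inactive k.+1 (leqW nk).
  by rewrite /=; case: (upcross f k) => -[] //= _; rewrite fk.
have finish n : (upcross f n).1 ->
    exists2 k, (n <= k)%N & ((upcross f n).2 < (upcross f k).2)%N.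
  move=> sn; apply: contrapT => none.
  have same k : (n <= k)%N -> (upcross f k).2 = (upcross f n).2.
    move=> nk; apply/eqP; rewrite eqn_leq (upcross_nondecreasing _ nk) andbT leqNgt.
    by apply/negP => h; apply: none; exists k.
  have active k : (n <= k)%N -> (upcross f k).1.
    elim: k => [|k IH]; first by rewrite leqn0 => /eqP n0; move: sn; rewrite n0.
    rewrite leq_eqVlt => /predU1P[<-//|]; rewrite ltnS => nk.
    have := IH nk; have := same _ (leqW nk); rewrite -(same _ nk) /=.
    case: (upcross f k) => -[] //= N + _; rewrite ltNge; case: (b <= f k.+1) => //=.
    by rewrite addn1 => /eqP; rewrite eqn_leq ltnn.
  have [[//|k] nk fk] := fb n.+1.
  have := active _ (leqW nk : (n <= k.+1)%N); have := active k nk => /=.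
  by case: (upcross f k) => -[] //= N _; rewrite ltNge fk.
elim=> [|N [n Nn]]; first by exists 0%N.
have [k nk sk] := start n; have [l kl lN] := finish k sk.
exists l; apply: leq_ltn_trans lN; apply: leq_trans Nn _.
exact: upcross_nondecreasing.
Qed.

(** The potential that makes Doob's counting argument additive: it never
    increases at times when no upcrossing is in progress, and moves by at most
    the increment of the process otherwise. *)
Definition upcross_potential f n : R :=
  (b - a) * (upcross f n).2%:R + (if (upcross f n).1 then f n else a).

Lemma upcross_potential_active f n : (upcross f n).1 ->
  upcross_potential f n.+1 <= (b - a) * (upcross f n).2%:R + f n.+1.
Proof.
rewrite /upcross_potential /=; case: (upcross f n) => -[] //= N _.
rewrite ltNge; case: (boolP (b <= f n.+1)) => bf /=; last by rewrite addn0.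
by rewrite addn1 -natr1 mulrDr mulr1 -addrA lerD2l; lra.
Qed.

Lemma upcross_potential_inactive f n : ~~ (upcross f n).1 ->
  upcross_potential f n.+1 <= upcross_potential f n.
Proof.
rewrite /upcross_potential /=; case: (upcross f n) => -[] //= N _.
by case: (boolP (f n.+1 <= a)) => //= fa; rewrite lerD2l.
Qed.

End upcrossings.

(** The limit is the infimum of the bounds that f meets infinitely often.  If f
    also exceeded a larger number infinitely often, it would cross a rational
    interval infinitely often. *)
Lemma upcross_cvg (R : realType) (f : nat -> R) :
  (forall n, 0 <= f n) -> (exists M, frequently_le f M) ->
  (forall p q : rat, 0 <= p < q -> exists M : R,
    frequently_le (fun n => (upcross (ratr p) (ratr q) f n).2%:R) M) ->
  cvg (f @ \oo).
Proof.
move=> f0 [M0 fM0] bounded.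
pose A := [set M | frequently_le f M].
have A0 M : A M -> 0 <= M.
  by move=> AM; have [k _] := AM 0%N; apply: le_trans.
have infA : has_inf A by split; [exists M0|exists 0 => M; exact: A0].
have few (M M' : R) : frequently_le f M -> frequently_ge f M' -> M' <= M.
  move=> fM fM'; rewrite leNgt; apply/negP => MM'.
  have [p] := rat_in_itvoo MM'; rewrite in_itv /= => /andP[Mp pM'].
  have [q] := rat_in_itvoo pM'; rewrite in_itv /= => /andP[pq qM'].
  have p0 : 0 <= p by rewrite -(@ler0q R); apply: le_trans (ltW Mp); exact: A0.
  have [|K hK] := bounded p q; first by rewrite p0 -(@ltr_rat R).
  have fp : frequently_le f (ratr p).
    by move=> n; have [k nk fk] := fM n; exists k => //; apply: le_trans (ltW Mp).
  have fq : frequently_ge f (ratr q).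
    by move=> n; have [k nk fk] := fM' n; exists k => //; apply: le_trans (ltW qM') _.
  have [n Kn] := upcross_unbounded fp fq (Num.bound `|K|).
  have [k nk] := hK n; apply/negP; rewrite -ltNge.
  apply: lt_le_trans (_ : (Num.bound `|K|)%:R <= _).
    by apply: le_lt_trans (ler_norm _) _; exact: archi_boundP.
  by rewrite ler_nat (leq_trans Kn)//; exact: upcross_nondecreasing.
apply/cvg_ex; exists (inf A); apply/cvgrPdist_lt => e e0.
have lo : \forall n \near \oo, inf A - e < f n.
  apply: contrapT => h; have : A (inf A - e).
    move=> n; apply: contrapT => none; apply: h; exists n => // k nk /=.
    by rewrite ltNge; apply/negP => fk; apply: none; exists k.
  move=> /(ge_inf infA.2); lra.
have hi : \forall n \near \oo, f n < inf A + e.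
  apply: contrapT => h.
  have fge : frequently_ge f (inf A + e).
    move=> n; apply: contrapT => none; apply: h; exists n => // k nk /=.
    by rewrite ltNge; apply/negP => fk; apply: none; exists k.
  have [M AM Me] := inf_adherent e0 infA.
  by have := few _ _ AM fge; rewrite leNgt Me.
near=> n.
have h1 : inf A - e < f n by near: n.
have h2 : f n < inf A + e by near: n.
by rewrite ltr_norml; apply/andP; split; lra.
Unshelve. all: by end_near. Qed.

(** * Integrals of nonnegative real functions *)

Section nonneg_real_integral.
Local Open Scope ereal_scope.
Context {d : measure_display} {T : measurableType d} {R : realType}.
Context (P : {measure set T -> \bar R}).
Implicit Types (f g : T -> R) (A : set T).

Let mE A f : measurable_fun setT f -> measurable_fun A (EFin \o f).
Proof. by move=> mf; exact/measurable_funTS/measurable_EFinP. Qed.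

Lemma integralD_ge0 A f g : measurable A ->
  measurable_fun setT f -> measurable_fun setT g ->
  (forall w, 0 <= f w)%R -> (forall w, 0 <= g w)%R ->
  \int[P]_(w in A) (f w + g w)%:E =
  \int[P]_(w in A) (f w)%:E + \int[P]_(w in A) (g w)%:E.
Proof.
move=> mA mf mg f0 g0; under eq_integral do rewrite EFinD.
by rewrite ge0_integralD//; try exact: mE; move=> w _; rewrite lee_fin.
Qed.

Lemma le_integral_ge0 A f g : measurable A ->
  measurable_fun setT f -> measurable_fun setT g ->
  (forall w, 0 <= f w)%R -> (forall w, A w -> f w <= g w)%R ->
  \int[P]_(w in A) (f w)%:E <= \int[P]_(w in A) (g w)%:E.
Proof.
move=> mA mf mg f0 fg; apply: ge0_le_integral => //; try exact: mE.
  by move=> w _; rewrite lee_fin.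
Qed.

Lemma integral_split A f : measurable A -> measurable_fun setT f ->
  (forall w, 0 <= f w)%R ->
  \int[P]_w (f w)%:E = \int[P]_(w in A) (f w)%:E + \int[P]_(w in ~` A) (f w)%:E.
Proof.
move=> mA mf f0; rewrite -ge0_integral_setU ?setUv//.
- exact: measurableC.
- exact: mE.
- by move=> w _; rewrite lee_fin.
- by rewrite disj_set2E setICr.
Qed.

Lemma integral_if A (B : T -> bool) f : measurable A ->
  measurable_fun setT B -> measurable_fun setT f -> (forall w, 0 <= f w)%R ->
  \int[P]_(w in A) (if B w then f w else 0%R)%:E =
  \int[P]_(w in A `&` [set w | B w]) (f w)%:E.
Proof.
move=> mA mB mf f0; rewrite integral_mkcondr; apply: eq_integral => w _.
rewrite /patch; case: ifPn => Bw; first by rewrite mem_set.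
by rewrite memNset//=; apply/negP.
Qed.

Lemma ge0_integral_ge0 A f : (forall w, 0 <= f w)%R ->
  0 <= \int[P]_(w in A) (f w)%:E.
Proof. by move=> f0; apply: integral_ge0 => w _; rewrite lee_fin. Qed.

(** By Fatou's lemma the limit inferior has a finite integral, hence is almost
    surely finite. *)
Lemma fatou_frequently (f : nat -> T -> R) (C : R) :
  (forall n, measurable_fun setT (f n)) -> (forall n w, 0 <= f n w)%R ->
  (forall n, \int[P]_w (f n w)%:E <= C%:E) ->
  {ae P, forall w, exists M, frequently_le (fun n => f n w) M}.
Proof.
move=> mf f0 fC.
pose g w := limn_einf (fun n => (f n w)%:E).
have g0 w : 0 <= g w.
  rewrite /g limn_einf_lim; apply: lime_ge; first exact: is_cvg_einfs.
  by apply: nearW => n; apply: le_ereal_inf_tmp => _ [k /= nk <-]; rewrite lee_fin.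
have mg : measurable_fun setT g.
  apply: (emeasurable_fun_cvg (fun n w => einfs (fun k => (f k w)%:E) n)).
    by move=> n; apply: measurable_fun_einfs => k; exact: mE.
  by move=> w _; rewrite /g limn_einf_lim; exact: is_cvg_einfs.
have gC : \int[P]_w g w <= C%:E.
  apply: le_trans (fatou P measurableT (fun n => mE (mf n)) _) _.
    by move=> n w _; rewrite /= lee_fin.
  rewrite limn_einf_lim; apply: lime_le; first exact: is_cvg_einfs.
  apply: nearW => n; apply: ereal_inf_le; exists (\int[P]_w (f n w)%:E) => //.
  by exists n => /=.
have ig : P.-integrable setT g.
  apply/integrableP; split => //.
  under eq_integral do rewrite gee0_abs//.
  by apply: le_lt_trans gC _; rewrite ltry.
apply: filterS (integrable_ae measurableT ig) => w /(_ I) gfin.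
exists (fine (g w) + 1)%R => n; apply: contrapT => none.
have : (fine (g w) + 1)%:E <= g w.
  rewrite [leRHS](_ : g w = ereal_sup (range (einfs (fun n => (f n w)%:E)))); last first.
    by rewrite /g limn_einf_lim; apply: cvg_lim => //; exact: cvg_einfs_sup.
  apply: (@le_trans _ _ (einfs (fun n => (f n w)%:E) n)).
    apply: le_ereal_inf_tmp => _ [k /= nk <-]; rewrite lee_fin leNgt.
    by apply/negP => fk; apply: none; exists k => //; exact: ltW.
  by apply: ereal_sup_ubound; exists n.
by rewrite -[in leRHS](fineK gfin) lee_fin gerDl ler10.
Qed.

End nonneg_real_integral.

(** * Almost supermartingales *)

Definition adapted {d : measure_display} {T : measurableType d} {R : realType}
    (G : nat -> set (set T)) (f : nat -> T -> R) : Prop :=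
  forall n, sub_measurable (G n) (f n).

Section almost_supermartingale.
Local Open Scope ereal_scope.
Context {d : measure_display} {T : measurableType d} {R : realType}.
Context (P : probability T R) (G : nat -> set (set T)).
Hypothesis subG : forall n, <<s G n >> `<=` measurable.
Hypothesis filtG : forall n, <<s G n >> `<=` <<s G n.+1 >>.

Let mT d' (U : measurableType d') (f : T -> U) n :
  sub_measurable (G n) f -> measurable_fun [set: T] f.
Proof. exact: (sub_measurable_measurable (@subG n)). Qed.

Let mS d' (U : measurableType d') (f : T -> U) n :
  sub_measurable (G n) f -> sub_measurable (G n.+1) f.
Proof. by move=> mf _ B mB; apply: filtG; exact: mf. Qed.

Let Gset (B : T -> bool) n : sub_measurable (G n) B ->
  <<s G n >> [set w | B w].
Proof.
move=> mB; have := mB measurableT [set true] I.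
by rewrite setTI; congr (<<s _ >> _); apply/seteqP; split=> w /=; case: (B w).
Qed.

Section bounded_errors.
Context (v u e : nat -> T -> R) (K : R).
Hypotheses (v0 : forall n w, (0 <= v n w)%R) (u0 : forall n w, (0 <= u n w)%R)
  (e0 : forall n w, (0 <= e n w)%R).
Hypotheses (mv : adapted G v) (mu : adapted G u) (me : adapted G e).
Arguments mv : clear implicits.
Arguments mu : clear implicits.
Arguments me : clear implicits.
Hypothesis step : forall n A, <<s G n >> A ->
  \int[P]_(w in A) (v n.+1 w + u n w)%:E <= \int[P]_(w in A) (v n w + e n w)%:E.
Hypothesis v0K : \int[P]_w (v 0%N w)%:E <= K%:E.
Hypothesis eK : forall n, \sum_(k < n) \int[P]_w (e k w)%:E <= K%:E.

Let GT n : <<s G n >> [set: T].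
Proof. exact: (measurableT : measurable [set: g_sigma_algebraType (G n)]). Qed.

Let v_sum n : \int[P]_w (v n w + \sum_(k < n) u k w)%:E <= (K + K)%:E.
Proof.
have mu' k : measurable_fun setT (fun w => \sum_(i < k) u i w)%R.
  by apply: measurable_sum => i; exact: (mT (mu i)).
have u0' k w : (0 <= \sum_(i < k) u i w)%R by exact: sumr_ge0.
suff : \int[P]_w (v n w + \sum_(k < n) u k w)%:E <=
    \int[P]_w (v 0%N w)%:E + \sum_(k < n) \int[P]_w (e k w)%:E.
  by move=> h; apply: le_trans h _; rewrite EFinD leeD.
elim: n => [|n IH].
  rewrite big_ord0 adde0; apply: le_integral_ge0 => //.
  - apply: measurable_funD => //; exact: (mT (mv 0%N)).
  - exact: (mT (mv 0%N)).
  - by move=> w; rewrite addr_ge0.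
  - by move=> w _; rewrite big_ord0 addr0.
rewrite big_ord_recr /= addeA.
under eq_integral do rewrite big_ord_recr /= addrCA.
rewrite integralD_ge0//; first last.
- by move=> w; rewrite addr_ge0.
- exact: u0'.
- by apply: measurable_funD; [exact: (mT (mv n.+1))|exact: (mT (mu n))].
- exact: mu'.
apply: (@le_trans _ _ (\int[P]_w (\sum_(i < n) u i w)%R%:E +
    \int[P]_w (v n w + e n w)%:E)).
  by rewrite leeD2l//; exact: step.
rewrite integralD_ge0//; [|exact: (mT (mv n))|exact: (mT (me n))].
rewrite addeA leeD2r// -integralD_ge0//; last exact: (mT (mv n)).
by under eq_integral do rewrite addrC.
Qed.

(* the potential is an almost supermartingale with the same errors as v *)
Let upcross_frequently (a b : R) : (0 <= a)%R -> (a < b)%R ->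
  {ae P, forall w, exists M : R,
    frequently_le (fun n => (upcross a b (v^~ w) n).2%:R) M}.
Proof.
move=> a0 ab.
pose s n w := (upcross a b (v^~ w) n).1.
pose N n w : R := (upcross a b (v^~ w) n).2%:R.
pose W n w : R := upcross_potential a b (v^~ w) n.
have msN n : sub_measurable (G n) (s n) /\ sub_measurable (G n) (N n).
  elim: n => [|n [msn mNn]].
    split; last exact: measurable_cst.
    by apply: measurable_fun_ler => //; exact: mv.
  have sE w : s n.+1 w = if s n w then (v n.+1 w < b)%R else (v n.+1 w <= a)%R.
    by rewrite /s /=; case: (upcross _ _ _ n) => -[].
  have NE w : N n.+1 w = (N n w + (if s n w then (b <= v n.+1 w)%R%:R else 0))%R.
    rewrite /N /s /=; case: (upcross _ _ _ n) => -[] k /=; last by rewrite addr0.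
    by rewrite natrD.
  split.
    rewrite (funext sE).
    apply: measurable_fun_ifT; first exact: mS.
      by apply: measurable_fun_ltr => //; exact: mv.
    by apply: measurable_fun_ler => //; exact: mv.
  rewrite (funext NE).
  apply: measurable_funD; first exact: mS.
  apply: measurable_fun_ifT; [exact: mS| |exact: measurable_cst].
  rewrite (_ : (fun w => _) = (fun w => if (b <= v n.+1 w)%R then 1 else 0)%R).
    by apply: measurable_fun_ifT => //; apply: measurable_fun_ler => //; exact: mv.
  by apply/funext => w; case: (_ <= _)%R.
have ms n : sub_measurable (G n) (s n) by exact: (msN n).1.
have mN n : sub_measurable (G n) (N n) by exact: (msN n).2.
have mW n : sub_measurable (G n) (W n).
  apply: measurable_funD; first by apply: measurable_funM.
  by apply: measurable_fun_ifT => //; exact: mv.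
have N0 n w : (0 <= (b - a) * N n w)%R by rewrite mulr_ge0// subr_ge0 ltW.
have W0 n w : (0 <= W n w)%R by apply: addr_ge0; [exact: N0|case: ifP].
have mbN n : measurable_fun [set: T] (fun w => (b - a) * N n w)%R.
  by apply: measurable_funM => //; exact: (mT (mN n)).
(* split according to whether an upcrossing is in progress at time n *)
have W_step n : \int[P]_w (W n.+1 w)%:E <= \int[P]_w (W n w)%:E + \int[P]_w (e n w)%:E.
  pose A := [set w | s n w].
  have GA : <<s G n >> A by apply: Gset; exact: ms.
  have mA : measurable A by exact: subG GA.
  have mA' : measurable (~` A) by exact: measurableC.
  have mWn k : measurable_fun [set: T] (W k) by exact: (mT (mW k)).
  have mvn k : measurable_fun [set: T] (v k) by exact: (mT (mv k)).
  have men k : measurable_fun [set: T] (e k) by exact: (mT (me k)).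
  rewrite (integral_split P mA)// (integral_split P mA (f := W n))//.
  rewrite addeAC; apply: leeD; last first.
    apply: le_integral_ge0 => // w /= sw.
    by apply: upcross_potential_inactive; apply/negP.
  apply: (@le_trans _ _ (\int[P]_(w in A) ((b - a) * N n w + (v n.+1 w + u n w))%:E)).
    apply: le_integral_ge0 => //.
      apply: measurable_funD => //; apply: measurable_funD => //; exact: (mT (mu n)).
    move=> w sw; apply: le_trans (upcross_potential_active sw) _.
    by rewrite lerD2l lerDl.
  rewrite integralD_ge0//; first last.
  - by move=> w; rewrite addr_ge0.
  - by apply: measurable_funD => //; exact: (mT (mu n)).
  apply: (@le_trans _ _ (\int[P]_(w in A) ((b - a) * N n w)%:E +
      \int[P]_(w in A) (v n w + e n w)%:E)).
    by rewrite leeD2l//; exact: step.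
  rewrite integralD_ge0// addeA leeD//.
    rewrite -integralD_ge0//; apply: le_integral_ge0 => //.
    + exact: measurable_funD.
    + by move=> w; rewrite addr_ge0.
    + by move=> w sw; rewrite /W /upcross_potential -/(s n w) sw.
  rewrite [leRHS](integral_split P mA)// leeDl//; exact: ge0_integral_ge0.
have W_le n : \int[P]_w (W n w)%:E <= (a + K)%:E.
  suff : \int[P]_w (W n w)%:E <= a%:E + \sum_(k < n) \int[P]_w (e k w)%:E.
    by move=> h; apply: le_trans h _; rewrite EFinD leeD2l.
  elim: n => [|n IH].
    rewrite big_ord0 adde0.
    apply: (@le_trans _ _ (\int[P]_(w in setT) cst a%:E w)); last first.
      have PT : P [set: T] = 1%E by exact: probability_setT.
      by rewrite integral_cst// [X in _ * X]PT mule1.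
    apply: (le_integral_ge0 P (g := cst a)) => //; first exact: (mT (mW 0%N)).
    by move=> w _; rewrite /W /upcross_potential /= mulr0 add0r; case: ifP.
  rewrite big_ord_recr /= addeA; apply: le_trans (W_step n) _.
  by rewrite leeD2r.
have ba0 : (0 < b - a)%R by rewrite subr_gt0.
apply: filterS (fatou_frequently (P := P) (f := fun n w => ((b - a) * N n w)%R)
  (C := (a + K)%R) mbN N0 _).
  move=> w [M hM]; exists (M / (b - a))%R => n; have [k nk h] := hM n.
  by exists k => //; rewrite ler_pdivlMr// mulrC.
move=> n; apply: le_trans (W_le n).
apply: le_integral_ge0 => //; first exact: (mT (mW n)).
by move=> w _; rewrite lerDl; case: ifP.
Qed.

(** Bounded errors bound the means of v and of the partial sums of u, so that
    Fatou's lemma excludes an infinite limit inferior of v and an infinite total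
    of u; the upcrossing potential bounds the mean number of upcrossings. *)
Lemma bounded_almost_supermartingale_cvg :
  {ae P, forall w, cvg (v n w @[n --> \oo]) /\ u n w @[n --> \oo] --> (0 : R)%R}.
Proof.
have mu' k : measurable_fun setT (fun w => \sum_(i < k) u i w)%R.
  by apply: measurable_sum => i; exact: (mT (mu i)).
have u0' k w : (0 <= \sum_(i < k) u i w)%R by exact: sumr_ge0.
have mvn k : measurable_fun [set: T] (v k) by exact: (mT (mv k)).
have freq_v : {ae P, forall w, exists M, frequently_le (v^~ w) M}.
  apply: (@fatou_frequently _ _ _ P v (K + K)%R) => // n.
  apply: le_trans (v_sum n).
  apply: le_integral_ge0 => //; first exact: measurable_funD.
  by move=> w _; rewrite lerDl.
have freq_u : {ae P, forall w, exists M,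
    frequently_le (fun n => \sum_(i < n) u i w)%R M}.
  apply: (@fatou_frequently _ _ _ P (fun n w => \sum_(i < n) u i w)%R (K + K)%R) => // n.
  apply: le_trans (v_sum n).
  apply: le_integral_ge0 => //; first exact: measurable_funD.
  by move=> w _; rewrite lerDr.
have freq_up : {ae P, forall w, forall pq : nat,
    if unpickle pq : option (rat * rat) is Some (p, q) then
      (0 <= p < q)%R -> exists M : R,
      frequently_le (fun n => (upcross (ratr p) (ratr q) (v^~ w) n).2%:R) M
    else True}.
  apply: ae_foralln => pq; case: unpickle => [[p q]|]; last by apply: aeW.
  case: (boolP (0 <= p < q)%R) => [/andP[p0 pq']|npq]; last by apply: aeW.
  have := @upcross_frequently (ratr p) (ratr q); rewrite ler0q ltr_rat.
  by move=> /(_ p0 pq'); apply: filterS => w h _.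
apply: filterS3 freq_up freq_v freq_u.
move=> w up fv [M fu]; split.
  apply: upcross_cvg => // p q pq.
  by have := up (pickle (p, q)); rewrite pickleK => /(_ pq).
pose S n := (\sum_(i < n) u i w)%R.
have Snd : {homo S : n k / (n <= k)%N >-> (n <= k)%R}.
  apply: homo_leq => [//|? ? ?|n]; first exact: le_trans.
  by rewrite /S big_ord_recr /= lerDl.
have Scvg : cvg (S @ \oo).
  apply: nondecreasing_is_cvgn => //; exists M => _ [n _ <-].
  by have [k nk] := fu n; apply: le_trans; exact: Snd.
have S1 : S n.+1 @[n --> \oo] --> lim (S @ \oo) by rewrite (cvg_shiftS S).
rewrite -(subrr (lim (S @ \oo))).
rewrite (_ : (fun n => u n w) = (fun n => S n.+1 - S n)%R); last first.
  by apply/funext => n; rewrite /S big_ord_recr /= addrAC subrr add0r.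
exact: cvgB.
Qed.

End bounded_errors.

(** Localisation: killing the process at the first time the initial value or
    the accumulated errors exceed K yields bounded errors, and the killing time
    is predictable, so the step inequality survives. *)
Theorem almost_supermartingale_cvg (v u e : nat -> T -> R) :
  (forall n w, (0 <= v n w)%R) -> (forall n w, (0 <= u n w)%R) ->
  (forall n w, (0 <= e n w)%R) ->
  adapted G v -> adapted G u -> adapted G e ->
  (forall n A, <<s G n >> A ->
    \int[P]_(w in A) (v n.+1 w + u n w)%:E <=
    \int[P]_(w in A) (v n w + e n w)%:E) ->
  {ae P, forall w, exists M, forall n, (\sum_(k < n) e k w <= M)%R} ->
  {ae P, forall w, cvg (v n w @[n --> \oo]) /\ u n w @[n --> \oo] --> (0 : R)%R}.
Proof.
move=> v0 u0 e0 mv mu me step eM.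
have mv' n : measurable_fun [set: T] (v n) by exact: (mT (mv n)).
have mu' n : measurable_fun [set: T] (u n) by exact: (mT (mu n)).
have me' n : measurable_fun [set: T] (e n) by exact: (mT (me n)).
pose alive (K n : nat) w := (v 0%N w <= K%:R)%R && (\sum_(k < n.+1) e k w <= K%:R)%R.
have mle n k (f : nat -> T -> R) : adapted G f -> (k <= n)%N -> sub_measurable (G n) (f k).
  move=> mf; elim: n => [|n IH]; first by rewrite leqn0 => /eqP ->; exact: mf.
  rewrite leq_eqVlt => /predU1P[->|]; first exact: mf.
  by rewrite ltnS => /IH; exact: mS.
have malive K n : sub_measurable (G n) (alive K n).
  apply: measurable_and; first by apply: measurable_fun_ler => //; exact: mle.
  apply: measurable_fun_ler => //; apply: measurable_sum => i.
  by apply: mle => //; rewrite -ltnS.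
have alive_le K n k w : (n <= k)%N -> alive K k w -> alive K n w.
  move=> nk /andP[vK eK]; rewrite /alive vK/=; apply: le_trans eK.
  rewrite -(subnKC (nk : (n.+1 <= k.+1)%N)) big_split_ord /= lerDl.
  exact: sumr_ge0.
(* v at time n is killed by the errors known one step earlier; n.-1 makes time 0
   use its own *)
pose vK (K n : nat) w : R := if alive K n.-1 w then v n w else 0%R.
pose uK (K n : nat) w : R := if alive K n w then u n w else 0%R.
pose eK (K n : nat) w : R := if alive K n w then e n w else 0%R.
have killed (K : nat) : {ae P, forall w,
    cvg (vK K n w @[n --> \oo]) /\ uK K n w @[n --> \oo] --> (0 : R)%R}.
  have mK (f : nat -> T -> R) n : adapted G f ->
      sub_measurable (G n) (fun w => if alive K n w then f n w else 0%R).
    by move=> mf; apply: measurable_fun_ifT; [exact: malive|exact: mf|exact: measurable_cst].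
  have vK0 n w : (0 <= vK K n w)%R by rewrite /vK; case: ifP.
  have uK0 n w : (0 <= uK K n w)%R by rewrite /uK; case: ifP.
  have eK0 n w : (0 <= eK K n w)%R by rewrite /eK; case: ifP.
  have mvK n : sub_measurable (G n) (vK K n).
    case: n => [|n]; first exact: mK.
    apply: measurable_fun_ifT; [|exact: mv|exact: measurable_cst].
    by apply: mS; exact: malive.
  have muK n : sub_measurable (G n) (uK K n) by exact: mK.
  have meK n : sub_measurable (G n) (eK K n) by exact: mK.
  have mvK' n : measurable_fun [set: T] (vK K n) by exact: (mT (mvK n)).
  have meK' n : measurable_fun [set: T] (eK K n) by exact: (mT (meK n)).
  have PT : P [set: T] = 1%E by exact: probability_setT.
  have KT : \int[P]_(w in setT) cst (K%:R%:E : \bar R) w = K%:R%:E.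
    by rewrite integral_cst// [X in _ * X]PT mule1.
  apply: (@bounded_almost_supermartingale_cvg (vK K) (uK K) (eK K) K%:R) => //.
  - move=> n A GA; have mA : measurable A by exact: subG GA.
    have malive' : measurable_fun [set: T] (alive K n) by exact: (mT (malive K n)).
    pose S := A `&` [set w | alive K n w].
    have GS : <<s G n >> S.
      exact: (@measurableI _ (g_sigma_algebraType (G n)) A _ GA (Gset (malive K n))).
    have mS' : measurable S by exact: subG GS.
    apply: (@le_trans _ _ (\int[P]_(w in S) (v n w + e n w)%:E)).
      apply: le_trans (step n S GS); rewrite -integral_if//; last 2 first.
      + exact: measurable_funD.
      + by move=> w; rewrite addr_ge0.
      rewrite le_eqVlt; apply/orP; left; apply/eqP; apply: eq_integral => w _.
      by rewrite /vK /uK /=; case: ifP => // _; rewrite addr0.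
    rewrite -integral_if//; last 2 first.
    + exact: measurable_funD.
    + by move=> w; rewrite addr_ge0.
    apply: le_integral_ge0 => //.
    + apply: measurable_fun_ifT => //; exact: measurable_funD.
    + exact: measurable_funD.
    + by move=> w; case: ifP => // _; rewrite addr_ge0.
    + move=> w _; rewrite /vK /eK; case: ifP => [aw|_]; last by rewrite addr0; case: ifP.
      by rewrite (alive_le _ _ _ _ (leq_pred n) aw).
  - rewrite -KT; apply: (le_integral_ge0 P (g := cst K%:R)) => // w _.
    by rewrite /vK /=; case: ifP => // /andP[].
  - move=> n; rewrite -KT -(ge0_integral_sum P measurableT); last 2 first.
    + by move=> k; apply/measurable_EFinP.
    + by move=> k w _; rewrite lee_fin.
    under eq_integral do rewrite sumEFin.
    apply: (le_integral_ge0 P (g := cst K%:R)) => //.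
    + by apply: measurable_sum => k.
    + by move=> w; apply: sumr_ge0.
    move=> w _ /=; elim: n => [|n IH]; first by rewrite big_ord0.
    case: (boolP (alive K n w)) => aw; last first.
      by rewrite big_ord_recr /= {2}/eK (negbTE aw) addr0.
    case/andP: (aw) => _; apply: le_trans; apply: ler_sum => k _.
    by rewrite /eK; case: ifP.
have all_killed : {ae P, forall w, forall K : nat,
    cvg (vK K n w @[n --> \oo]) /\ uK K n w @[n --> \oo] --> (0 : R)%R}.
  by apply: ae_foralln => K; exact: killed.
apply: filterS2 eM all_killed => w [M eM] kw.
pose K := Num.bound (Num.max `|v 0%N w| `|M|)%R.
have KM : (Num.max `|v 0%N w| `|M| < K%:R)%R.
  by apply: archi_boundP; rewrite le_max normr_ge0.
move: KM; rewrite gt_max => /andP[vK' MK].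
have aw n : alive K n w.
  apply/andP; split; first exact: le_trans (ler_norm _) (ltW vK').
  by apply: le_trans (eM _) _; apply: le_trans (ler_norm _) (ltW MK).
have [cv cu] := kw K; split.
  by rewrite (_ : (fun n => v n w) = (vK K)^~ w)//; apply/funext => n; rewrite /vK aw.
by rewrite (_ : (fun n => u n w) = (uK K)^~ w)//; apply/funext => n; rewrite /uK aw.
Qed.

End almost_supermartingale.

(** * Borel maps into separable spaces *)

Section separable_normed.
Context {R : realType}.

Lemma separable_seq (V : normedModType R) : separable V ->
  exists s : nat -> V, forall x e, 0 < e -> exists n, `|x - s n| < e.
Proof.
move=> [S [cS dS]].
have [S0|[f]] := pfcard_geP cS.
  by have [|x []] := dS setT _ openT; [exists 0|rewrite S0].
exists f => x e e0.
have [|y [/= xy Sy]] := dS (ball x e) _ (@ball_open _ _ x e).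
  by exists x; exact: ballxx.
by have [n _ fn] := 'surj_f Sy; exists n; rewrite fn; move: xy; rewrite -ball_normE.
Qed.

Lemma hsum_separable (m : nat) (H : 'I_m -> hilbertType R) :
  (forall i, separable (H i)) -> separable (hsum H).
Proof.
move=> sH.
have seqs i := cid (separable_seq (sH i)).
pose s i := sval (seqs i).
have sP i : forall x e, 0 < e -> exists n, `|x - s i n| < e.
  exact: svalP (seqs i).
pose g (f : {ffun 'I_m -> nat}) : hsum H := fun i => s i (f i).
exists (range g); split.
  by apply: sub_countable (countableP (setT : set {ffun 'I_m -> nat})); exact: card_image_le.
move=> O [x Ox] oO.
have : \forall y \near x, O y by exact: open_nbhs_nbhs.
move=> /nbhs_ballP[e /= e0 xO].
have d0 : 0 < e / m.+1%:R by rewrite divr_gt0.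
have /choice[f fP] : forall i, exists n, `|x i - s i n| < e / m.+1%:R.
  by move=> i; exact: sP.
exists (g (finfun f)); split; last by exists (finfun f).
apply: xO; rewrite -ball_normE /=.
apply: (le_lt_trans (hsum_norm_le _)).
apply: (@le_lt_trans _ _ (\sum_(i < m) e / m.+1%:R)).
  apply: ler_sum => i _; apply: ltW; have := fP i.
  by rewrite -{1}(ffunE f i).
rewrite sumr_const card_ord -[ltLHS]mulr_natr mulrAC ltr_pdivrMr//.
by rewrite ltr_pM2l// ltr_nat.
Qed.

End separable_normed.

Section borel_measurability.
Context {R : realType} {d : measure_display} {T : measurableType d}.

Lemma borel_rv_open (X : ptopologicalType) (f : T -> X) :
  (forall O, open O -> measurable (f @^-1` O)) -> borel_rv f.
Proof.
move=> h; apply: (measurability (rT := borel X) (@open X)) => //.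
by move=> _ [U oU <-]; rewrite setTI; exact: h.
Qed.

Lemma borel_rv_measurable (X : ptopologicalType) (f : T -> X) (O : set X) :
  borel_rv f -> open O -> measurable (f @^-1` O).
Proof.
move=> mf oO; rewrite -[X in measurable X]setTI; apply: mf => //.
exact: sub_sigma_algebra.
Qed.

Lemma borel_rv_real (X : ptopologicalType) (f : T -> X) (phi : X -> R) :
  borel_rv f -> continuous phi -> measurable_fun [set: T] (phi \o f).
Proof.
move=> mf /continuousP cphi.
apply: (measurability _ (RGenOpens.measurableE R)).
move=> _ [_ [a [b ->] <-]]; rewrite setTI.
exact: (borel_rv_measurable mf (cphi _ (interval_open _ _))).
Qed.

(** Separability makes the Borel sigma-algebra of a product generated by
    rectangles, so a continuous function of two Borel maps is Borel. *)
Lemma borel_rv_pair (X Y : normedModType R) (Z : ptopologicalType)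
    (f : T -> X) (g : T -> Y) (phi : X * Y -> Z) :
  separable X -> separable Y -> borel_rv f -> borel_rv g -> continuous phi ->
  borel_rv (fun w => phi (f w, g w)).
Proof.
move=> /separable_seq[s sP] /separable_seq[t tP] mf mg /continuousP cphi.
apply: borel_rv_open => O oO.
pose good (i : nat * nat * nat) := forall x y,
  ball (s i.1.1) i.2.+1%:R^-1 x -> ball (t i.1.2) i.2.+1%:R^-1 y -> O (phi (x, y)).
rewrite (_ : _ @^-1` _ = \bigcup_i (if pselect (good i) then
   f @^-1` (ball (s i.1.1) i.2.+1%:R^-1) `&`
   g @^-1` (ball (t i.1.2) i.2.+1%:R^-1) else set0)).
  apply: countable_bigcupT_measurable => // i.
  case: pselect => /= [_|_] //; apply: measurableI.
    by apply: (borel_rv_measurable mf); exact: ball_open.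
  by apply: (borel_rv_measurable mg); exact: ball_open.
apply/seteqP; split=> w /=; last first.
  by move=> [i _]; case: pselect => //= gi [fw gw]; exact: gi.
move=> Ow.
have : nbhs (f w, g w) (phi @^-1` O).
  by apply: open_nbhs_nbhs; split => //; exact: cphi.
move=> /nbhs_ballP[e /= e0 be].
have [k _ ke] : \forall k \near \oo, k.+1%:R^-1 < e / 2.
  have := @cvg_harmonic R; move=> /cvgr_lt; apply; exact: divr_gt0.
have {}ke : (k.+1%:R^-1 : R) < e / 2 by apply: ke => /=.
have k0 : 0 < (k.+1%:R^-1 : R) by rewrite invr_gt0.
have [i fi] := sP (f w) _ k0; have [j gj] := tP (g w) _ k0.
exists (i, j, k) => //; case: pselect => /= [gi|].
  by split; rewrite /= -ball_normE /= distrC.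
case=> x y; rewrite -!ball_normE /= => xi yj; apply: be.
split; rewrite -ball_normE /=.
  rewrite -(subrKA (s i)); apply: le_lt_trans (ler_normD _ _) _.
  by rewrite [ltRHS](splitr e); apply: ltrD; [exact: lt_trans ke|exact: lt_trans ke].
rewrite -(subrKA (t j)); apply: le_lt_trans (ler_normD _ _) _.
by rewrite [ltRHS](splitr e); apply: ltrD; [exact: lt_trans ke|exact: lt_trans ke].
Qed.

(** Closed balls with centres in a dense sequence and radii 1 / (k + 1) suffice
    to exhaust an open set. *)
Lemma borel_rv_norm_le (V : normedModType R) (g : T -> V) : separable V ->
  (forall s r, 0 < r -> measurable [set w | `|g w - s| <= r]) -> borel_rv g.
Proof.
move=> /separable_seq[s sP] mg; apply: borel_rv_open => O oO.
pose good (i : nat * nat) := forall x, `|x - s i.1| <= i.2.+1%:R^-1 -> O x.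
rewrite (_ : _ @^-1` _ = \bigcup_i (if pselect (good i) then
   [set w | `|g w - s i.1| <= i.2.+1%:R^-1] else set0)).
  by apply: countable_bigcupT_measurable => // i; case: pselect => /= [_|_] //; exact: mg.
apply/seteqP; split=> w /=; last first.
  by move=> [i _]; case: pselect => //= gi gw; exact: gi.
move=> Ow.
have : \forall y \near g w, O y by exact: open_nbhs_nbhs.
move=> /nbhs_ballP[e /= e0 be].
have [k _ ke] : \forall k \near \oo, k.+1%:R^-1 < e / 2.
  have := @cvg_harmonic R; move=> /cvgr_lt; apply; exact: divr_gt0.
have {}ke : (k.+1%:R^-1 : R) < e / 2 by apply: ke => /=.
have k0 : 0 < (k.+1%:R^-1 : R) by rewrite invr_gt0.
have [i fi] := sP (g w) _ k0.
exists (i, k) => //; case: pselect => /= [gi|]; first exact: ltW.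
case=> x /= xi; apply: be; rewrite -ball_normE /=.
rewrite -(subrKA (s i)); apply: le_lt_trans (ler_normD _ _) _.
rewrite [ltRHS](splitr e); apply: ltrD; first exact: lt_trans ke.
by rewrite distrC; exact: le_lt_trans ke.
Qed.

(** Norms in a separable Hilbert space are countable suprema of inner products,
    |v|^2 = sup_d (2 <v, d> - |d|^2), so weak limits of Borel maps are Borel. *)
Lemma borel_rv_weak_cvg (H : hilbertType R) (f : nat -> T -> H) (g : T -> H) :
  separable H -> (forall n, borel_rv (f n)) ->
  (forall w, weak_cvg (fun n => f n w) (g w)) -> borel_rv g.
Proof.
move=> sH mf fg; have [t tP] := separable_seq sH.
apply: borel_rv_norm_le => // s r r0.
rewrite (_ : mkset _ =
  \bigcap_j [set w | 2 * inner (g w - s) (t j) - `|t j| ^+ 2 <= r ^+ 2]).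
  apply: bigcapT_measurable => j.
  have mgj : measurable_fun [set: T] (fun w => inner (g w) (t j)).
    apply: (measurable_fun_cvg (h := fun n w => inner (f n w) (t j))).
      move=> n; apply: (borel_rv_real (phi := fun y => inner y (t j)) (mf n)).
      by move=> y; apply: inner_cvgl; exact: cvg_id.
    by move=> w _; exact: fg.
  have mh : measurable_fun [set: T]
      (fun w => 2 * inner (g w - s) (t j) - `|t j| ^+ 2).
    under eq_fun do rewrite innerDl.
    apply: measurable_funB; last exact: measurable_cst.
    apply: measurable_funM; first exact: measurable_cst.
    by apply: measurable_funD; [exact: mgj|exact: measurable_cst].
  have /(_ measurableT [set true] I) := measurable_fun_ler mh (measurable_cst (r ^+ 2)).
  by rewrite setTI; congr measurable; apply/seteqP; split=> w /=.
apply/seteqP; split=> w /= => [gr j _ /=|hw].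
  move: (g w - s) gr => v vr.
  have : `|v| ^+ 2 <= r ^+ 2 by rewrite ler_pXn2r ?nnegrE ?(ltW r0).
  have := sqr_ge0 `|v - t j|; rewrite sqr_normB; lra.
have {hw} : forall j, 2 * inner (g w - s) (t j) - `|t j| ^+ 2 <= r ^+ 2.
  by move=> j; exact: (hw j I).
move: (g w - s) => v h; rewrite -(@ler_pXn2r _ 2)// ?nnegrE ?(ltW r0)//.
apply/ler_addgt0Pr => e e0.
have q0 : 0 < Num.sqrt e by rewrite sqrtr_gt0.
have [j gj] := tP v _ q0.
have : `|v - t j| ^+ 2 <= e.
  by rewrite -[leRHS](sqr_sqrtr (ltW e0)) ler_pXn2r ?nnegrE ?sqrtr_ge0// ltW.
have := h j; rewrite sqr_normB; lra.
Qed.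

End borel_measurability.

(** * One randomly swept relaxed step *)

Lemma lipschitz_continuous (R : realType) (V W : normedModType R)
    (f : V -> W) (k : R) :
  (forall x y, `|f x - f y| <= k * `|x - y|) -> continuous f.
Proof.
move=> fk x; apply/subr_cvg0.
apply: (@norm_le_cvg0 _ _ _ _ _ _ (fun y => k * `|y - x|)) => //.
rewrite -(mulr0 k); apply: cvgMr; apply/norm_cvg0P/subr_cvg0; exact: cvg_id.
Qed.

Section random_sweep.
Context {R : realType} {m : nat} {H : 'I_m -> hilbertType R}.
Context (E : finType) (act : E -> 'I_m -> bool) (q : E -> R) (p : 'I_m -> R).
Hypothesis q_ge0 : forall e, 0 <= q e.
Hypothesis q_sum : \sum_e q e = 1.
Hypothesis p_sum : forall i, \sum_(e | act e i) q e = p i.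
Hypothesis p_gt0 : forall i, 0 < p i.
Implicit Types x y t z : hsum H.

Definition mask (e : E) (l : R) (y : hsum H) : hsum H :=
  fun i => ((act e i)%:R * l) *: y i.

Lemma maskB e l y z : mask e l y - mask e l z = mask e l (y - z).
Proof. by apply/functional_extensionality_dep => i; rewrite /mask -[LHS]scalerBr. Qed.

Lemma maskD e l y z : mask e l (y + z) = mask e l y + mask e l z.
Proof. by apply/functional_extensionality_dep => i; rewrite /mask -[RHS]scalerDr. Qed.

Lemma mask_norm e l y : 0 <= l <= 1 -> `|mask e l y| <= `|y|.
Proof.
move=> /andP[l0 l1]; rewrite -(@ler_pXn2r _ 2)// ?nnegrE// !hsum_sqnormE.
apply: ler_sum => i _; rewrite /mask normrZ exprMn.
rewrite ler_piMl ?sqr_ge0// expr_le1// normrM.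
case: (act e i); first by rewrite normr1 mul1r ger0_norm.
by rewrite normr0 mul0r.
Qed.

Lemma sweep_mean_coord (i : 'I_m) (f : bool -> R) :
  \sum_e q e * f (act e i) = p i * f true + (1 - p i) * f false.
Proof.
rewrite (bigID (fun e => act e i)) /=; congr (_ + _).
  rewrite -(p_sum i) mulr_suml; apply: eq_bigr => e ei; by rewrite ei.
rewrite -q_sum [in RHS](bigID (fun e => act e i)) /= p_sum addrAC subrr add0r.
by rewrite mulr_suml; apply: eq_bigr => e /negbTE ->.
Qed.

Let w (i : 'I_m) := (p i)^-1.

(** Weighting each coordinate by the inverse of its activation probability
    makes the mean of the squared weighted distance after one random sweep see
    the full, unswept, relaxed step. *)
Lemma sweep_mean_sqnorm l x t z :
  \sum_e q e * `|wscale w (x + mask e l (t - x) - z)| ^+ 2 =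
  `|wscale w (x - z)| ^+ 2 - `|x - z| ^+ 2 + `|x + l *: (t - x) - z| ^+ 2.
Proof.
have w0 i : 0 <= w i by rewrite invr_ge0 ltW.
under eq_bigr do rewrite wscale_sqnorm// mulr_sumr.
rewrite exchange_big /= wscale_sqnorm// !hsum_sqnormE -sumrB -big_split /=.
apply: eq_bigr => i _.
pose f (b : bool) := w i * `|x i + (b%:R * l) *: (t i - x i) - z i| ^+ 2.
rewrite (eq_bigr (fun e => q e * f (act e i)))// sweep_mean_coord /f.
rewrite mul1r mul0r scale0r addr0 /w.
rewrite -[`|(x - z) i|]/(`|x i - z i|).
rewrite -[`|(x + l *: (t - x) - z) i|]/(`|x i + l *: (t i - x i) - z i|).
move: (`|_ - _| ^+ 2) (`|_ - _| ^+ 2) => r s.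
by field; exact: lt0r_neq0.
Qed.

Lemma mean_sqr_le (h : E -> R) : (\sum_e q e * h e) ^+ 2 <= \sum_e q e * h e ^+ 2.
Proof.
have := cauchy_schwarz_sum (fun e => Num.sqrt (q e)) (fun e => Num.sqrt (q e) * h e).
under eq_bigr do rewrite mulrA -expr2 sqr_sqrtr//.
under [X in _ <= X * _]eq_bigr do rewrite sqr_sqrtr//.
under [X in _ <= _ * X]eq_bigr do rewrite exprMn sqr_sqrtr//.
by rewrite q_sum mul1r.
Qed.

(** The unsquared distance decreases in mean, with a gain proportional to the
    decrease of the squared distance: s^2 <= V^2 - delta gives
    delta <= (V - s) (V + s) <= 2 (V + 1) (V - s). *)
Lemma sweep_mean_norm l x t z delta :
  `|x + l *: (t - x) - z| ^+ 2 <= `|x - z| ^+ 2 - delta -> 0 <= delta ->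
  \sum_e q e * `|wscale w (x + mask e l (t - x) - z)|
    + delta / (2 * (`|wscale w (x - z)| + 1)) <= `|wscale w (x - z)|.
Proof.
move=> hd d0; set s := \sum_e _; set V := `|wscale w (x - z)|.
have V0 : 0 <= V by exact: normr_ge0.
have s0 : 0 <= s by apply: sumr_ge0 => e _; rewrite mulr_ge0.
have s2 : s ^+ 2 <= V ^+ 2 - delta.
  by apply: le_trans (mean_sqr_le _) _; rewrite sweep_mean_sqnorm -/V; lra.
have sV : s <= V.
  by rewrite -(@ler_pXn2r _ 2)// ?nnegrE//; lra.
rewrite -lerBrDl ler_pdivrMr; last by lra.
have : (V - s) * (V + s) <= (V - s) * (2 * (V + 1)).
  by apply: ler_wpM2l; lra.
have -> : (V - s) * (V + s) = V ^+ 2 - s ^+ 2 by ring.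
lra.
Qed.

End random_sweep.

Section relaxed_step.
Context {R : realType} {m : nat} {H : 'I_m -> hilbertType R}.
Context (A : forall i, H i -> set (H i)) (B : forall i, hsum H -> H i).
Arguments A : clear implicits.
Arguments B : clear implicits.
Hypothesis A_maxmon : forall i, maximally_monotone (A i).
Context (theta : R).
Hypothesis theta_gt0 : 0 < theta.
Hypothesis B_cocoercive : forall x y : hsum H,
  theta * (\sum_i `|B i x - B i y| ^+ 2) <=
    \sum_i inner (x i - y i) (B i x - B i y).

Definition bwd (g : R) (y : hsum H) : hsum H :=
  fun i => resolvent (op_scale g (A i)) (y i).

Lemma bwd_lip g x y : 0 < g -> `|bwd g x - bwd g y| <= `|x - y|.
Proof.
move=> g0; rewrite -(@ler_pXn2r _ 2)// ?nnegrE// !hsum_sqnormE.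
apply: ler_sum => i _; rewrite ler_pXn2r ?nnegrE//.
exact: (resolvent_lip (A_maxmon i)).
Qed.

Lemma bwd_continuous g : 0 < g -> continuous (bwd g).
Proof.
by move=> g0; apply: (@lipschitz_continuous _ _ _ _ 1) => x y; rewrite mul1r bwd_lip.
Qed.

Lemma fwd_continuous : continuous (fwd B).
Proof. exact: lipschitz_continuous (fwd_lip theta_gt0 B_cocoercive). Qed.

Lemma fwd_bwd_continuous g : 0 < g -> continuous (fwd_bwd A B g).
Proof.
move=> g0 x.
apply: (@continuous_comp _ _ _ (fun y => y - g *: fwd B y) (bwd g)).
  apply: (@cvgB _ _ _ (nbhs x)); first exact: cvg_id.
  by apply: (@cvgZr _ _ _ (nbhs x)); exact: fwd_continuous.
exact: bwd_continuous.
Qed.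

Definition residual (g : R) (z x : hsum H) : R :=
  `|fwd B x - fwd B z| ^+ 2
  + `|x - fwd_bwd A B g x - g *: (fwd B x - fwd B z)| ^+ 2.

Lemma residual_ge0 g z x : 0 <= residual g z x.
Proof. by rewrite addr_ge0// sqr_ge0. Qed.

Lemma residual_continuous g z : 0 < g -> continuous (residual g z).
Proof.
move=> g0 x.
have sqr_norm_cvg (f : hsum H -> hsum H) :
    continuous f -> `|f y| ^+ 2 @[y --> x] --> `|f x| ^+ 2.
  move=> cf; apply: (cvg_comp _ (fun r : R => r ^+ 2) (cvg_norm (cf x))).
  exact: exprn_continuous.
have cfz : continuous (fun y => fwd B y - fwd B z).
  move=> y; apply: (@cvgB _ _ _ (nbhs y)); [exact: fwd_continuous|exact: cvg_cst].
apply: (@cvgD _ _ _ (nbhs x)); first exact: (sqr_norm_cvg _ cfz).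
apply: (sqr_norm_cvg (fun y => y - fwd_bwd A B g y - g *: (fwd B y - fwd B z))).
move=> y; apply: (@cvgB _ _ _ (nbhs y)).
  apply: (@cvgB _ _ _ (nbhs y)); first exact: cvg_id.
  exact: fwd_bwd_continuous.
by apply: (@cvgZr _ _ _ (nbhs y)); exact: cfz.
Qed.

(** Convexity of the squared distance to z transfers the decrease of the full
    step to the relaxed one. *)
Lemma relaxed_step_ineq g l x z (k : R) : 0 < g -> 0 < l <= 1 ->
  inclusion_solutions A B z -> k <= l -> k <= l * (g * (2 * theta - g)) ->
  `|x + l *: (fwd_bwd A B g x - x) - z| ^+ 2 <= `|x - z| ^+ 2 - k * residual g z x.
Proof.
move=> g0 /andP[l0 l1] zS kl kgl.
set t := fwd_bwd A B g x.
have convex : `|x + l *: (t - x) - z| ^+ 2 <=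
    (1 - l) * `|x - z| ^+ 2 + l * `|t - z| ^+ 2.
  have -> : x + l *: (t - x) - z = (x - z) + l *: ((t - z) - (x - z)).
    by rewrite opprB addrA subrK addrAC.
  move: (t - z) (x - z) => a b.
  have := mulr_ge0 (mulr_ge0 (ltW l0) (_ : 0 <= 1 - l)) (sqr_ge0 `|a - b|).
  rewrite subr_ge0 => /(_ l1).
  rewrite [`|b + l *: _| ^+ 2]sqr_normD innerZr normrZ exprMn (ger0_norm (ltW l0)) innerDr innerNr.
  rewrite inner_normE !sqr_normB (innerC b a) => h.
  rewrite -subr_ge0; apply: le_trans h _; rewrite le_eqVlt; apply/orP; left.
  by apply/eqP; ring.
apply: le_trans convex _.
have := fwd_bwd_ineq A_maxmon B_cocoercive x g0 zS.
rewrite -/t /residual -/t => h.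
have := ler_wpM2l (ltW l0) h.
have := ler_wpM2r (sqr_ge0 `|fwd B x - fwd B z|) kgl.
have := ler_wpM2r (sqr_ge0 `|x - t - g *: (fwd B x - fwd B z)|) kl.
lra.
Qed.

End relaxed_step.

(** * Measurability of the iterates *)

Section more_integrals.
Local Open Scope ereal_scope.
Context {d : measure_display} {T : measurableType d} {R : realType}.
Context (P : {measure set T -> \bar R}).
Implicit Types (f g : T -> R) (A : set T).

Lemma integral_sum_ge0 (E : finType) A (f : E -> T -> R) : measurable A ->
  (forall e, measurable_fun setT (f e)) -> (forall e w, 0 <= f e w)%R ->
  \int[P]_(w in A) (\sum_e f e w)%:E = \sum_e \int[P]_(w in A) (f e w)%:E.
Proof.
move=> mA mf f0; under eq_integral do rewrite -sumEFin.
rewrite (ge0_integral_sum P mA)//.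
  by move=> e; exact/measurable_funTS/measurable_EFinP.
by move=> e w _; rewrite lee_fin.
Qed.

Lemma le_integralD f f' g g' A : measurable A ->
  measurable_fun setT f -> measurable_fun setT f' ->
  measurable_fun setT g -> measurable_fun setT g' ->
  (forall w, 0 <= f w)%R -> (forall w, 0 <= f' w)%R ->
  (forall w, 0 <= g w)%R -> (forall w, 0 <= g' w)%R ->
  \int[P]_(w in A) (f w)%:E <= \int[P]_(w in A) (g w)%:E ->
  \int[P]_(w in A) (f' w)%:E <= \int[P]_(w in A) (g' w)%:E ->
  \int[P]_(w in A) (f w + f' w)%:E <= \int[P]_(w in A) (g w + g' w)%:E.
Proof.
by move=> mA mf mf' mg mg' f0 f'0 g0 g'0 h h'; rewrite !integralD_ge0// leeD.
Qed.

Lemma le_integralZ f g A (k : R) : measurable A ->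
  measurable_fun setT f -> measurable_fun setT g ->
  (forall w, 0 <= f w)%R -> (forall w, 0 <= g w)%R -> (0 <= k)%R ->
  \int[P]_(w in A) (f w)%:E <= \int[P]_(w in A) (g w)%:E ->
  \int[P]_(w in A) (k * f w)%:E <= \int[P]_(w in A) (k * g w)%:E.
Proof.
move=> mA mf mg f0 g0 k0 h.
under eq_integral do rewrite EFinM; under [leRHS]eq_integral do rewrite EFinM.
rewrite !ge0_integralZl//; last 4 first.
- exact/measurable_funTS/measurable_EFinP.
- by move=> w _; rewrite lee_fin.
- exact/measurable_funTS/measurable_EFinP.
- by move=> w _; rewrite lee_fin.
by rewrite lee_wpmul2l// lee_fin.
Qed.

End more_integrals.

Section iteration.
Context {R : realType} {d : measure_display} {T : measurableType d}
  {P : probability T R} {m : nat} {H : 'I_m -> hilbertType R}.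
Hypothesis H_separable : forall i, separable (H i).
Context (A : forall i, H i -> set (H i)) (B : forall i, hsum H -> H i).
Arguments A : clear implicits.
Arguments B : clear implicits.
Hypothesis A_maxmon : forall i, maximally_monotone (A i).
Context (theta : R).
Hypothesis theta_gt0 : 0 < theta.
Hypothesis B_cocoercive : forall x y : hsum H,
  theta * (\sum_i `|B i x - B i y| ^+ 2) <=
    \sum_i inner (x i - y i) (B i x - B i y).
Context (gamma lambda : nat -> R).
Hypothesis gamma_in : forall n, 0 < gamma n < 2 * theta.
Hypothesis lambda_in : forall n, 0 < lambda n <= 1.
Context (x a c : nat -> T -> hsum H) (eps : nat -> T -> sweep m).
Arguments x : clear implicits.
Hypothesis x0_rv : borel_rv (x 0%N).
Hypothesis a_rv : forall n, borel_rv (a n).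
Hypothesis c_rv : forall n, borel_rv (c n).
Hypothesis eps_rv : forall n, sweep_rv (eps n).
Hypothesis x_iter : forall n w i,
  x n.+1 w i = x n w i +
    ((val (eps n w) i)%:R * lambda n) *:
      (resolvent (op_scale (gamma n) (A i))
         (x n w i - gamma n *: (B i (x n w) + c n w i))
       + a n w i - x n w i).

Let act (e : sweep m) (i : 'I_m) : bool := val e i.
Let g_gt0 n : 0 < gamma n. Proof. by case/andP: (gamma_in n). Qed.
Let l_bnd n : 0 <= lambda n <= 1.
Proof. by case/andP: (lambda_in n) => /ltW -> ->. Qed.

Let perturbed n w := bwd A (gamma n) (x n w - gamma n *: (fwd B (x n w) + c n w)).

Lemma iterate_rec n w : x n.+1 w =
  x n w + mask act (eps n w) (lambda n) (perturbed n w + a n w - x n w).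
Proof. by apply/functional_extensionality_dep => i; exact: x_iter. Qed.

Lemma iterate_borel n : borel_rv (x n).
Proof.
have sH : separable (hsum H) by exact: hsum_separable.
elim: n => // n IH.
have h1 : borel_rv (perturbed n).
  apply: (borel_rv_pair (phi := fun p : hsum H * hsum H =>
    bwd A (gamma n) (p.1 - gamma n *: (fwd B p.1 + p.2))) sH sH IH (c_rv n)).
  move=> p; apply: (@continuous_comp _ _ _
    (fun p : hsum H * hsum H => p.1 - gamma n *: (fwd B p.1 + p.2)) (bwd A (gamma n))).
    apply: (@cvgB _ _ _ (nbhs p)); first exact: cvg_fst.
    apply: (@cvgZr _ _ _ (nbhs p)); apply: (@cvgD _ _ _ (nbhs p)).
      apply: (cvg_comp _ (fwd B) (@cvg_fst _ _ (nbhs p.1) (nbhs p.2) _)).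
      exact: (fwd_continuous theta_gt0 B_cocoercive).
    exact: cvg_snd.
  exact: bwd_continuous.
have h2 : borel_rv (fun w => perturbed n w + a n w).
  apply: (borel_rv_pair (phi := fun p : hsum H * hsum H => p.1 + p.2) sH sH h1 (a_rv n)).
  exact: add_continuous.
(* on each of the finitely many events fixing the sweep, the update is a
   continuous function of Borel maps *)
apply: borel_rv_open => O oO.
rewrite (_ : _ @^-1` _ = \bigcup_(e in [set: sweep m]) ((eps n @^-1` [set e]) `&`
    (fun w => x n w + mask act e (lambda n) (perturbed n w + a n w - x n w)) @^-1` O)).
  apply: countable_bigcupT_measurable => [|e]; first exact: countableP.
  apply: measurableI; first exact: eps_rv.
  apply: borel_rv_measurable oO.
  apply: (borel_rv_pair (phi := fun p : hsum H * hsum H =>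
     p.1 + mask act e (lambda n) (p.2 - p.1)) sH sH IH h2).
  move=> p; apply: (@cvgD _ _ _ (nbhs p)); first exact: cvg_fst.
  apply: (@continuous_comp _ _ _ (fun p : hsum H * hsum H => p.2 - p.1)
    (mask act e (lambda n))).
    by apply: (@cvgB _ _ _ (nbhs p)); [exact: cvg_snd|exact: cvg_fst].
  apply: (@lipschitz_continuous _ _ _ _ 1) => y z.
  by rewrite maskB mul1r mask_norm.
apply/seteqP; split=> w /=; rewrite iterate_rec; first by exists (eps n w).
by move=> [e _ [/= ->]].
Qed.

(** Only a generating family, since [g_sigma_algebraType] expects one; the
    sigma-algebra it generates is [sigma_upto x n] by definition. *)
Definition past n : set (set T) := \bigcup_(k in `I_n.+1)
  preimage_set_system [set: T] (x k) (@measurable _ (borel (hsum H))).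

Lemma past_measurable n : <<s past n >> `<=` measurable.
Proof.
apply: smallest_sub; first exact: sigma_algebra_measurable.
by move=> _ [k _ [U mU <-]]; exact: iterate_borel.
Qed.

Lemma past_filtration n : <<s past n >> `<=` <<s past n.+1 >>.
Proof.
apply: smallest_sub; first exact: smallest_sigma_algebra.
move=> U [k /= kn xU]; apply: sub_sigma_algebra; exists k => //=.
exact: ltnW.
Qed.

Lemma iterate_past n : borel_rv (x n : g_sigma_algebraType (past n) -> hsum H).
Proof.
move=> _ U mU; apply: sub_sigma_algebra; exists n; first exact: ltnSn.
by exists U.
Qed.

End iteration.

(** * Mean decrease of the weighted distance *)

Section mean_step.
Context {R : realType} {d : measure_display} {T : measurableType d}
  {P : probability T R} {m : nat} {H : 'I_m -> hilbertType R}.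
Hypothesis H_separable : forall i, separable (H i).
Context (A : forall i, H i -> set (H i)) (B : forall i, hsum H -> H i).
Arguments A : clear implicits.
Arguments B : clear implicits.
Hypothesis A_maxmon : forall i, maximally_monotone (A i).
Context (theta : R).
Hypothesis theta_gt0 : 0 < theta.
Hypothesis B_cocoercive : forall x y : hsum H,
  theta * (\sum_i `|B i x - B i y| ^+ 2) <=
    \sum_i inner (x i - y i) (B i x - B i y).
Context (gamma lambda : nat -> R).
Hypothesis gamma_in : forall n, 0 < gamma n < 2 * theta.
Hypothesis lambda_in : forall n, 0 < lambda n <= 1.
Context (x a c : nat -> T -> hsum H) (eps : nat -> T -> sweep m).
Arguments x : clear implicits.
Hypothesis x0_rv : borel_rv (x 0%N).
Hypothesis a_rv : forall n, borel_rv (a n).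
Hypothesis c_rv : forall n, borel_rv (c n).
Hypothesis eps_rv : forall n, sweep_rv (eps n).
Hypothesis eps_id : identically_distributed P eps.
Hypothesis x_iter : forall n w i,
  x n.+1 w i = x n w i +
    ((val (eps n w) i)%:R * lambda n) *:
      (resolvent (op_scale (gamma n) (A i))
         (x n w i - gamma n *: (B i (x n w) + c n w i))
       + a n w i - x n w i).
Hypothesis eps_indep : forall n,
  independent_systems P (sigma_sweep (eps n)) (sigma_upto x n).
Hypothesis eps_pos : forall i, (0 < P [set w | val (eps 0%N w) i])%E.

Let act (e : sweep m) (i : 'I_m) : bool := val e i.

Definition sweep_prob (e : sweep m) : R := fine (P (eps 0%N @^-1` [set e])).
Definition act_prob (i : 'I_m) : R := fine (P [set w | val (eps 0%N w) i]).

Let prob_fin U : measurable U -> P U \is a fin_num.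
Proof. by move=> mU; exact: fin_num_measure. Qed.

Let meps n (S : set (sweep m)) : measurable (eps n @^-1` S).
Proof. exact: eps_rv. Qed.

Lemma sweep_prob_ge0 e : 0 <= sweep_prob e.
Proof. by rewrite fine_ge0. Qed.

Lemma sweep_probE n e : P (eps n @^-1` [set e]) = (sweep_prob e)%:E.
Proof. by rewrite (eps_id n 0%N) fineK// prob_fin. Qed.

Let sweep_prob_sum (S : pred (sweep m)) :
  (\sum_(e | S e) sweep_prob e)%:E = P [set w | S (eps 0%N w)].
Proof.
pose f (e : sweep m) w : R := if S e then \1_(eps 0%N @^-1` [set e]) w else 0.
rewrite big_mkcond -sumEFin.
rewrite (eq_bigr (fun e => \int[P]_(w in setT) (f e w)%:E)%E); last first.
  move=> e _; rewrite /f; case: (S e); last by rewrite integral0.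
  by rewrite integral_indic// setIT -(sweep_probE 0%N).
rewrite -integral_sum_ge0//.
- rewrite -[in RHS](setIT [set w | _]) -integral_indic//; last exact: (meps 0%N [set e | S e]).
  apply: eq_integral => w _; congr EFin; rewrite (bigD1 (eps 0%N w))//= big1 ?addr0.
    rewrite /f !indicE; case: (boolP (S (eps 0%N w))) => Sw.
      by rewrite !mem_set.
    by rewrite memNset//=; exact/negP.
  move=> e ew; rewrite /f; case: ifP => // _; rewrite indicE memNset//=.
  by move=> we; rewrite we eqxx in ew.
- move=> e; rewrite /f; case: (S e); last exact: measurable_cst.
  by apply: measurable_indic; exact: meps.
- by move=> e w; rewrite /f; case: ifP => // _; rewrite indicE.
Qed.

Lemma sweep_prob_total : \sum_e sweep_prob e = 1.
Proof.
apply: EFin_inj; rewrite (sweep_prob_sum xpredT).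
transitivity (P [set: T]); last exact: probability_setT.
by congr (P _); apply/seteqP; split.
Qed.

Let act_fin i : P [set w | val (eps 0%N w) i] \is a fin_num.
Proof. exact: (prob_fin (meps 0%N [set e | act e i])). Qed.

Lemma act_prob_sum i : \sum_(e | act e i) sweep_prob e = act_prob i.
Proof.
by apply: EFin_inj; rewrite (sweep_prob_sum (act^~ i)) fineK//; exact: act_fin.
Qed.

Lemma act_prob_gt0 i : 0 < act_prob i.
Proof.
by rewrite fine_gt0// eps_pos/= -ge0_fin_numE//; exact: act_fin.
Qed.

Lemma act_prob_le1 i : act_prob i <= 1.
Proof.
rewrite -act_prob_sum -sweep_prob_total [leRHS](bigID (act^~ i))/= lerDl.
by apply: sumr_ge0 => e _; exact: sweep_prob_ge0.
Qed.

Definition weight (i : 'I_m) : R := (act_prob i)^-1.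

Lemma weight_ge1 i : 1 <= weight i.
Proof. by rewrite invf_ge1 ?act_prob_gt0// act_prob_le1. Qed.

(* C >= 1 gives C <= C ^+ 2, so that C ^+ 2 dominates every weight *)
Let C : R := 1 + \sum_i weight i.

Let weight_ge0 i : 0 <= weight i. Proof. exact: le_trans (weight_ge1 i). Qed.

Let C_ge1 : 1 <= C. Proof. by rewrite lerDl sumr_ge0. Qed.

Let weight_le i : 0 <= weight i <= C ^+ 2.
Proof.
rewrite weight_ge0/= (@le_trans _ _ C)//.
  by rewrite /C (bigD1 i)//= addrCA lerDl addr_ge0// sumr_ge0.
by rewrite expr2 ler_peMl// (le_trans _ C_ge1).
Qed.

Lemma wscale_weight_le (y : hsum H) : `|wscale weight y| <= C * `|y|.
Proof. by apply: wscale_le => //; exact: le_trans C_ge1. Qed.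

Let subG n : <<s past x n >> `<=` measurable.
Proof.
exact: (past_measurable H_separable A_maxmon theta_gt0 B_cocoercive gamma_in
  lambda_in x0_rv a_rv c_rv eps_rv x_iter).
Qed.

(* independence of the sweep from the past, as a pull-out property whose
   conditional expectation is constant *)
Let integral_sweep n (e : sweep m) (h : T -> R) U :
  sub_measurable (past x n) h -> (forall w, 0 <= h w) -> <<s past x n >> U ->
  (\int[P]_(w in U) (h w * \1_(eps n @^-1` [set e]) w)%:E =
   \int[P]_(w in U) (h w * sweep_prob e)%:E)%E.
Proof.
move=> mh h0 GU.
apply: (sub_integralM (subG (n := n)) (Y := cst (sweep_prob e)) _ _ _ _ _ mh h0 GU).
- exact: measurable_indic.
- exact: measurable_cst.
- by move=> w; rewrite indicE.
- by move=> w; exact: sweep_prob_ge0.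
move=> V GV; have mV : measurable V := subG GV.
have indep : P (eps n @^-1` [set e] `&` V) = (P (eps n @^-1` [set e]) * P V)%E.
  by apply: (eps_indep (n := n)) => //; exists [set e] => //; rewrite setTI.
rewrite integral_indic//.
transitivity ((sweep_prob e)%:E * P V)%E; first by rewrite -(sweep_probE n).
have cstV := integral_cst P mV (sweep_prob e)%:E.
by rewrite -cstV.
Qed.

Context (ea ec : nat -> T -> R) (r : nat -> R).
Hypothesis r_gt0 : forall n, 0 < r n.
Hypothesis ea_ge0 : forall n w, 0 <= ea n w.
Hypothesis ec_ge0 : forall n w, 0 <= ec n w.
Hypothesis mea : forall n, sub_measurable (past x n) (ea n).
Hypothesis mec : forall n, sub_measurable (past x n) (ec n).
Hypothesis ea_cond : forall n U, <<s past x n >> U ->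
  (\int[P]_(w in U) (`|a n w| ^+ 2)%:E = \int[P]_(w in U) (ea n w)%:E)%E.
Hypothesis ec_cond : forall n U, <<s past x n >> U ->
  (\int[P]_(w in U) (`|c n w| ^+ 2)%:E = \int[P]_(w in U) (ec n w)%:E)%E.
Context (k : R).
Hypothesis k_ge0 : 0 <= k.
Hypothesis k_le : forall n, k <= lambda n.
Hypothesis k_le' : forall n, k <= lambda n * (gamma n * (2 * theta - gamma n)).
Context (z : hsum H).
Hypothesis z_sol : inclusion_solutions A B z.

Let g_gt0 n : 0 < gamma n. Proof. by case/andP: (gamma_in n). Qed.

Definition dist_proc n w : R := `|wscale weight (x n w - z)|.
(** The summand 1 in the denominator makes this a continuous function of the
    iterate, hence adapted. *)
Definition gain_proc n w : R :=
  k * residual A B (gamma n) z (x n w) / (2 * (dist_proc n w + 1)).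
Definition error_proc n w : R :=
  C * (Num.sqrt (ea n w) + r n) + (C * (2 * theta)) * (Num.sqrt (ec n w) + r n).

Let swept n (e : sweep m) (y : hsum H) : R :=
  `|wscale weight (y + mask act e (lambda n) (fwd_bwd A B (gamma n) y - y) - z)|.

(** Resolvents and sweeps are nonexpansive, so the perturbations enter with
    their own norms, up to the step size. *)
Lemma dist_proc_step n w : dist_proc n.+1 w <=
  swept n (eps n w) (x n w) + (C * `|a n w| + (C * (2 * theta)) * `|c n w|).
Proof.
rewrite /dist_proc /swept (iterate_rec x_iter).
set t := fwd_bwd A B (gamma n) (x n w); set t' := bwd _ _ _.
have -> : x n w + mask act (eps n w) (lambda n) (t' + a n w - x n w) - z =
    (x n w + mask act (eps n w) (lambda n) (t - x n w) - z)
    + mask act (eps n w) (lambda n) (t' - t + a n w).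
  have -> : t' + a n w - x n w = (t - x n w) + (t' - t + a n w).
    by rewrite [RHS]addrC [t' - t + _]addrAC addrA subrK.
  by rewrite maskD addrA [LHS]addrAC.
rewrite wscaleD; apply: le_trans (ler_normD _ _) _; rewrite lerD2l.
apply: le_trans (wscale_weight_le _) _.
rewrite -mulrA -mulrDr ler_wpM2l ?(le_trans _ C_ge1)//.
apply: le_trans (mask_norm _ _ _ _) _.
  by case/andP: (lambda_in n) => /ltW -> ->.
apply: le_trans (ler_normD _ _) _; rewrite addrC lerD2l.
apply: le_trans (bwd_lip A_maxmon _ _ (g_gt0 n)) _.
have -> : x n w - gamma n *: (fwd B (x n w) + c n w)
    - (x n w - gamma n *: fwd B (x n w)) = - (gamma n *: c n w).
  rewrite scalerDr; move: (x n w) (gamma n *: _) (gamma n *: _) => y v u.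
  have -> : y - (u + v) = (y - u) - v by rewrite opprD addrA.
  by rewrite [LHS]addrAC subrr add0r.
rewrite normrN normrZ ler_wpM2r// ger0_norm ?(ltW (g_gt0 n))//.
by case/andP: (gamma_in n) => _ /ltW.
Qed.

Let cdist : continuous (fun y : hsum H => `|wscale weight (y - z)|).
Proof.
apply: (@lipschitz_continuous _ _ _ _ C) => y y'.
have -> : y - y' = (y - z) - (y' - z) by rewrite opprB addrA subrK.
apply: le_trans (ler_dist_dist _ _) _; rewrite -wscaleB; exact: wscale_weight_le.
Qed.

Let cswept n e : continuous (swept n e).
Proof.
move=> y.
apply: (@continuous_comp _ _ _
  (fun y => y + mask act e (lambda n) (fwd_bwd A B (gamma n) y - y))
  (fun y : hsum H => `|wscale weight (y - z)|)); last exact: cdist.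
apply: (@cvgD _ _ _ (nbhs y)); first exact: cvg_id.
apply: (@continuous_comp _ _ _ (fun y => fwd_bwd A B (gamma n) y - y)
  (mask act e (lambda n))).
  apply: (@cvgB _ _ _ (nbhs y)); last exact: cvg_id.
  exact: (fwd_bwd_continuous A_maxmon theta_gt0 B_cocoercive (g_gt0 n)).
apply: (@lipschitz_continuous _ _ _ _ 1) => u v.
by rewrite maskB mul1r mask_norm//; case/andP: (lambda_in n) => /ltW -> ->.
Qed.

Let dist_ge0 n w : 0 <= dist_proc n w. Proof. exact: normr_ge0. Qed.

Lemma gain_ge0 n w : 0 <= gain_proc n w.
Proof.
rewrite divr_ge0 ?mulr_ge0 ?residual_ge0// addr_ge0//; exact: dist_ge0.
Qed.

Lemma error_ge0 n w : 0 <= error_proc n w.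
Proof.
have C0 : 0 <= C by exact: le_trans C_ge1.
have t0 : 0 <= 2 * theta by rewrite mulr_ge0// ltW.
have s0 (e : R) : 0 <= Num.sqrt e + r n by rewrite addr_ge0 ?sqrtr_ge0// ltW.
by apply: addr_ge0; apply: mulr_ge0 => //; apply: mulr_ge0.
Qed.

Lemma dist_adapted n : sub_measurable (past x n) (dist_proc n).
Proof. exact: (borel_rv_real (@iterate_past _ _ _ _ _ x n) cdist). Qed.

Lemma gain_adapted n : sub_measurable (past x n) (gain_proc n).
Proof.
apply: (borel_rv_real (phi := fun y => k * residual A B (gamma n) z y /
  (2 * (`|wscale weight (y - z)| + 1))) (@iterate_past _ _ _ _ _ x n)).
move=> y; apply: (@cvgM _ _ (nbhs y)).
  apply: (@cvgMl_tmp _ _ (nbhs y)).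
  exact: (residual_continuous A_maxmon theta_gt0 B_cocoercive (g_gt0 n)).
apply: (@cvgV _ _ (nbhs y)).
  by rewrite mulf_neq0// gt_eqF// ltr_wpDl.
apply: (@cvgMl_tmp _ _ (nbhs y)); apply: (@cvgD _ _ _ (nbhs y)); first exact: cdist.
exact: cvg_cst.
Qed.

Lemma error_adapted n : sub_measurable (past x n) (error_proc n).
Proof.
have msq (e : T -> R) : sub_measurable (past x n) e ->
    sub_measurable (past x n) (fun w => Num.sqrt (e w) + r n).
  move=> me; apply: measurable_funD; last exact: measurable_cst.
  apply: measurableT_comp me; apply: continuous_measurable_fun.
  exact: sqrt_continuous.
by apply: measurable_funD; apply: measurable_funM => //; exact: msq.
Qed.

Local Open Scope ereal_scope.

Let mT (f : T -> R) n : sub_measurable (past x n) f -> measurable_fun [set: T] f.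
Proof. exact: (sub_measurable_measurable (subG (n := n))). Qed.

(* independence turns the random sweep into its mean *)
Let mean_part n U : <<s past x n >> U ->
  \int[P]_(w in U) (\sum_e swept n e (x n w) * \1_(eps n @^-1` [set e]) w
    + gain_proc n w)%:E <= \int[P]_(w in U) (dist_proc n w)%:E.
Proof.
move=> GU; have mU : measurable U := subG GU.
have msw e : sub_measurable (past x n) (fun w => swept n e (x n w)).
  exact: (borel_rv_real (@iterate_past _ _ _ _ _ x n) (cswept (n := n) (e := e))).
have msw' e : measurable_fun [set: T] (fun w => swept n e (x n w)).
  exact: (mT (msw e)).
have mgain := mT (gain_adapted (n := n)).
have sw0 e w : (0 <= swept n e (x n w))%R by exact: normr_ge0.
have m1 e : measurable_fun [set: T]
    (fun w => swept n e (x n w) * \1_(eps n @^-1` [set e]) w)%R.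
  by apply: measurable_funM => //; apply: measurable_indic; exact: meps.
have m2 e : measurable_fun [set: T] (fun w => swept n e (x n w) * sweep_prob e)%R.
  by apply: measurable_funM.
have p1 e w : (0 <= swept n e (x n w) * \1_(eps n @^-1` [set e]) w)%R.
  by rewrite mulr_ge0// indicE.
have p2 e w : (0 <= swept n e (x n w) * sweep_prob e)%R.
  by rewrite mulr_ge0// sweep_prob_ge0.
rewrite integralD_ge0//; first last.
- exact: gain_ge0.
- by move=> w; exact: sumr_ge0.
- by apply: measurable_sum.
rewrite integral_sum_ge0//.
under eq_bigr do rewrite integral_sweep//.
rewrite -integral_sum_ge0// -integralD_ge0//; first last.
- exact: gain_ge0.
- by move=> w; exact: sumr_ge0.
- by apply: measurable_sum.
apply: le_integral_ge0 => //.
- by apply: measurable_funD => //; exact: measurable_sum.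
- exact: (mT (dist_adapted (n := n))).
- by move=> w; rewrite addr_ge0 ?gain_ge0//; exact: sumr_ge0.
move=> w _.
under eq_bigr do rewrite mulrC.
apply: (sweep_mean_norm sweep_prob_ge0 sweep_prob_total act_prob_sum act_prob_gt0).
  exact: (relaxed_step_ineq A_maxmon B_cocoercive).
by rewrite mulr_ge0// residual_ge0.
Qed.

(** Over an event of the past, the sweep of the unperturbed step integrates to
    its mean, which decreases, and the conditional Jensen inequality bounds the
    perturbations. *)
Lemma mean_step n U : <<s past x n >> U ->
  \int[P]_(w in U) (dist_proc n.+1 w + gain_proc n w)%:E <=
  \int[P]_(w in U) (dist_proc n w + error_proc n w)%:E.
Proof.
move=> GU; have mU : measurable U := subG GU.
have C0 : (0 <= C)%R by exact: le_trans C_ge1.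
have C0' : (0 <= C * (2 * theta))%R by rewrite mulr_ge0// mulr_ge0// ltW.
have mnorm f : borel_rv f -> measurable_fun [set: T] (fun w => `|f w : hsum H|)%R.
  by move=> mf; apply: (borel_rv_real mf); exact: norm_continuous.
have msq (e : T -> R) : sub_measurable (past x n) e ->
    measurable_fun [set: T] (fun w => Num.sqrt (e w) + r n)%R.
  move=> me; apply: measurable_funD; last exact: measurable_cst.
  apply: measurableT_comp (mT me); apply: continuous_measurable_fun.
  exact: sqrt_continuous.
have sq0 (e : T -> R) w : (0 <= Num.sqrt (e w) + r n)%R.
  by rewrite addr_ge0 ?sqrtr_ge0// ltW.
have mdist k' : measurable_fun [set: T] (dist_proc k').
  exact: (mT (dist_adapted (n := k'))).
have mgain : measurable_fun [set: T] (gain_proc n) by exact: (mT (gain_adapted (n := n))).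
pose sw w := (\sum_e swept n e (x n w) * \1_(eps n @^-1` [set e]) w)%R.
have swE w : sw w = swept n (eps n w) (x n w).
  rewrite /sw (bigD1 (eps n w))//= big1 ?addr0.
    by rewrite indicE mem_set// mulr1.
  move=> e ew; rewrite indicE memNset ?mulr0//=.
  by move=> we; rewrite we eqxx in ew.
have msw : measurable_fun [set: T] sw.
  apply: measurable_sum => e; apply: measurable_funM.
    apply: (mT (n := n)).
    exact: (borel_rv_real (@iterate_past _ _ _ _ _ x n) (cswept (n := n) (e := e))).
  by apply: measurable_indic; exact: meps.
have sw_ge0 w : (0 <= sw w)%R by rewrite swE; exact: normr_ge0.
have ma : measurable_fun [set: T] (fun w => C * `|a n w|)%R.
  by apply: measurable_funM => //; exact: mnorm.
have mc : measurable_fun [set: T] (fun w => (C * (2 * theta)) * `|c n w|)%R.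
  by apply: measurable_funM => //; exact: mnorm.
apply: (@le_trans _ _ (\int[P]_(w in U) ((sw w + gain_proc n w) +
    (C * `|a n w| + (C * (2 * theta)) * `|c n w|))%:E)).
  apply: le_integral_ge0 => //.
  - exact: measurable_funD.
  - by apply: measurable_funD; exact: measurable_funD.
  - by move=> w; rewrite addr_ge0// gain_ge0.
  move=> w _; rewrite addrAC lerD2r swE; exact: dist_proc_step.
apply: le_integralD => //.
- exact: measurable_funD.
- exact: measurable_funD.
- exact: (mT (error_adapted (n := n))).
- by move=> w; rewrite addr_ge0// gain_ge0.
- by move=> w; rewrite addr_ge0// mulr_ge0.
- exact: error_ge0.
- exact: mean_part.
apply: le_integralD => //.
- by apply: measurable_funM => //; exact: msq.
- by apply: measurable_funM => //; exact: msq.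
- by move=> w; rewrite mulr_ge0.
- by move=> w; rewrite mulr_ge0.
- by move=> w; rewrite mulr_ge0.
- by move=> w; rewrite mulr_ge0.
- apply: le_integralZ => //; [exact: mnorm|exact: msq|].
  exact: (cond_jensen_sqrt (subG (n := n)) (mnorm _ (a_rv n))
    (fun w => normr_ge0 _) (mea (n := n)) (ea_ge0 n) (ea_cond (n := n)) (r_gt0 n) GU).
- apply: le_integralZ => //; [exact: mnorm|exact: msq|].
  exact: (cond_jensen_sqrt (subG (n := n)) (mnorm _ (c_rv n))
    (fun w => normr_ge0 _) (mec (n := n)) (ec_ge0 n) (ec_cond (n := n)) (r_gt0 n) GU).
Qed.

Lemma error_bounded w :
  (exists M, forall n, (\sum_(k < n) Num.sqrt (ea k w) <= M)%R) ->
  (exists M, forall n, (\sum_(k < n) Num.sqrt (ec k w) <= M)%R) ->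
  (exists M, forall n, (\sum_(k < n) r k <= M)%R) ->
  exists M, forall n, (\sum_(k < n) error_proc k w <= M)%R.
Proof.
move=> [Ma hMa] [Mc hMc] [Mr hMr].
have C0 : (0 <= C)%R by exact: le_trans C_ge1.
have t0 : (0 <= 2 * theta)%R by rewrite mulr_ge0// ltW.
exists (C * (Ma + Mr) + (C * (2 * theta)) * (Mc + Mr))%R => n.
rewrite big_split /= -!mulr_sumr !big_split /=.
apply: lerD; first by apply: ler_wpM2l => //; exact: (lerD (hMa n) (hMr n)).
by apply: ler_wpM2l; [exact: mulr_ge0|exact: (lerD (hMc n) (hMr n))].
Qed.

End mean_step.

(** * Versions, dense sequences and summability *)

Section conditional_expectation.
Local Open Scope ereal_scope.
Context {d : measure_display} {T : measurableType d} {R : realType}.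
Context (P : probability T R) (G : set (set T)).
Hypothesis subG : <<s G >> `<=` measurable.

(** An almost surely finite version may be made real-valued: [fine] alters it
    on a null event of the sub-sigma-algebra only. *)
Lemma cond_expectation_fine (f : T -> R) (E : T -> \bar R) :
  is_cond_expectation P (<<s G >>) (fun w => (f w)%:E) E ->
  {ae P, forall w, E w < +oo} ->
  [/\ sub_measurable G (fine \o E), forall w, (0 <= fine (E w))%R &
   forall A, <<s G >> A ->
     \int[P]_(w in A) (f w)%:E = \int[P]_(w in A) (fine (E w))%:E].
Proof.
move=> [E0 mE EA] Efin.
have mE' : sub_measurable G E.
  by move=> _ Y mY; have := mE Y mY; rewrite -[X in <<s G >> X]setTI.
have mf : sub_measurable G (fine \o E).
  by apply: measurableT_comp mE' => //; exact: measurable_fine.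
split=> [//|w|A GA]; first exact: fine_ge0.
rewrite -EA//; apply: ge0_ae_eq_integral => //.
- exact: subG.
- exact/measurable_funTS/(sub_measurable_measurable subG mE').
- exact/measurable_funTS/measurable_EFinP/(sub_measurable_measurable subG mf).
- by move=> w _; rewrite lee_fin fine_ge0.
- apply: filterS Efin => w Ew _; rewrite fineK//.
  by rewrite ge0_fin_numE.
Qed.

End conditional_expectation.

Lemma sqrte_series_bounded (R : realType) (E : nat -> \bar R) :
  (forall n, (0 <= E n)%E) -> (\sum_(0 <= n <oo) sqrte (E n) < +oo)%E ->
  (forall n, (E n < +oo)%E) /\
  exists M, forall n, \sum_(k < n) Num.sqrt (fine (E k)) <= M.
Proof.
move=> E0 sE.
have s0 n : (0 <= sqrte (E n))%E by exact: sqrte_ge0.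
have partial n : (\sum_(0 <= k < n) sqrte (E k) <= \sum_(0 <= k <oo) sqrte (E k))%E.
  by apply: nneseries_lim_ge => k _ _.
have Efin n : (E n < +oo)%E.
  have : (sqrte (E n) < +oo)%E.
    apply: le_lt_trans sE; apply: le_trans (partial n.+1).
    by rewrite big_nat_recr//= leeDr// sume_ge0.
  by case: (E n) => //= v _; rewrite ltry.
split=> //; exists (fine (\sum_(0 <= k <oo) sqrte (E k)))%E => n.
rewrite -lee_fin fineK; last by rewrite ge0_fin_numE// nneseries_ge0.
apply: le_trans (partial n); rewrite big_mkord -sumEFin.
apply: lee_sum => k _.
by have := Efin k; have := E0 k; case: (E k).
Qed.

(** For each point of a sequence dense in V and each radius 1 / (j + 1), pick a
    point of S in that ball whenever there is one. *)
Lemma separable_subset_seq (R : realType) (V : normedModType R) (S : set V) :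
  separable V -> S !=set0 ->
  exists zs : nat -> V, (forall k, S (zs k)) /\
    forall z e, S z -> 0 < e -> exists k, `|z - zs k| < e.
Proof.
move=> /separable_seq[s sP] [z0 Sz0].
pose near_seq (i : nat * nat) : set V :=
  [set z | S z /\ `|z - s i.1| < i.2.+1%:R^-1].
pose pick (i : nat * nat) : V := xget z0 (near_seq i).
have pickS i : S (pick i).
  by rewrite /pick; case: xgetP => [z _ []|].
exists (fun k => if unpickle k is Some i then pick i else z0).
split=> [k|z e Sz e0]; first by case: unpickle.
have [j _ je] : \forall k \near \oo, (k.+1%:R^-1 : R) < e / 2.
  by have := @cvg_harmonic R; move=> /cvgr_lt; apply; exact: divr_gt0.
have {}je : (j.+1%:R^-1 : R) < e / 2 by apply: je => /=.
have j0 : 0 < (j.+1%:R^-1 : R) by rewrite invr_gt0.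
have [i zi] := sP z _ j0.
exists (pickle (i, j)); rewrite pickleK.
have [_ /= pi] : near_seq (i, j) (pick (i, j)) by apply: xgetPex; exists z.
rewrite -(subrKA (s i)); apply: le_lt_trans (ler_normD _ _) _.
rewrite [ltRHS](splitr e); apply: ltrD; first exact: lt_trans je.
by rewrite distrC; exact: lt_trans je.
Qed.

(** The weighted distances are Lipschitz in the point, uniformly in n, so a
    sequence of points at which they converge may be replaced by a limit
    point. *)
Lemma wdist_cvg_dense (R : realType) (m : nat) (H : 'I_m -> hilbertType R)
    (w : 'I_m -> R) (C : R) (xs zs : nat -> hsum H) (z : hsum H) :
  0 < C -> (forall y : hsum H, `|wscale w y| <= C * `|y|) ->
  (forall k, cvg (`|wscale w (xs n - zs k)| @[n --> \oo])) ->
  (forall e, 0 < e -> exists k, `|z - zs k| < e) ->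
  cvg (`|wscale w (xs n - z)| @[n --> \oo]).
Proof.
move=> C0 wC cvgk dense; apply: cauchy_cvg; apply/cauchy_exP => e e0.
have [k zk] : exists k, `|z - zs k| < e / 2 / C by apply: dense; rewrite !divr_gt0.
have /cvg_ex[l /= fl] := cvgk k.
have e2 : 0 < e / 2 by rewrite divr_gt0.
exists l; move/cvgrPdist_lt : fl => /(_ _ e2); apply: filterS => n /= ln.
rewrite -ball_normE /= -(subrKA `|wscale w (xs n - zs k)|).
apply: le_lt_trans (ler_normD _ _) _; rewrite [ltRHS](splitr e); apply: ltrD => //.
apply: le_lt_trans (ler_dist_dist _ _) _; rewrite -wscaleB.
apply: le_lt_trans (wC _) _; rewrite mulrC -ltr_pdivlMr//.
by rewrite opprB addrC subrKA.
Qed.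

Lemma half_series_bounded (R : realType) (n : nat) :
  \sum_(k < n) (2^-1 ^+ k : R) <= 2.
Proof.
have -> : \sum_(k < n) (2^-1 ^+ k : R) = 2 - 2 * 2^-1 ^+ n.
  elim: n => [|n IH]; first by rewrite big_ord0 expr0; lra.
  by rewrite big_ord_recr /= IH exprS; lra.
by rewrite lerBlDr lerDl mulr_ge0// exprn_ge0// invr_ge0.
Qed.

(** * Convergence of the block-coordinate iteration *)

Theorem proposition5p9 (R : realType)
    (d : measure_display) (T : measurableType d) (P : probability T R)
    (m : nat) (H : 'I_m -> hilbertType R)
    (H_separable : forall i, separable (H i))
    (A : forall i, H i -> set (H i))
    (A_maxmon : forall i, maximally_monotone (A i))
    (B : forall i, hsum H -> H i)
    (theta : R) (theta_gt0 : 0 < theta)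
    (B_cocoercive : forall x y : hsum H,
      theta * (\sum_i `|B i x - B i y| ^+ 2) <=
        \sum_i inner (x i - y i) (B i x - B i y))
    (F_nonempty : inclusion_solutions A B !=set0)
    (gamma : nat -> R)
    (gamma_in : forall n, 0 < gamma n < 2 * theta)
    (gamma_inf : 0 < inf (range gamma))
    (gamma_sup : sup (range gamma) < 2 * theta)
    (lambda : nat -> R)
    (lambda_in : forall n, 0 < lambda n <= 1)
    (lambda_inf : 0 < inf (range lambda))
    (x a c : nat -> T -> hsum H)
    (x0_rv : borel_rv (x 0%N))
    (a_rv : forall n, borel_rv (a n))
    (c_rv : forall n, borel_rv (c n))
    (eps : nat -> T -> sweep m)
    (eps_rv : forall n, sweep_rv (eps n))
    (eps_id : identically_distributed P eps)
    (x_iter : forall n w i,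
      x n.+1 w i = x n w i +
        ((val (eps n w) i)%:R * lambda n) *:
          (resolvent (op_scale (gamma n) (A i))
             (x n w i - gamma n *: (B i (x n w) + c n w i))
           + a n w i - x n w i))
    (* Ea n, Ec n: versions of E(|a_n|^2 | X_n), E(|c_n|^2 | X_n) *)
    (Ea Ec : nat -> T -> \bar R)
    (Ea_cond : forall n, is_cond_expectation P (sigma_upto x n)
      (fun w => (`|a n w| ^+ 2)%:E) (Ea n))
    (Ec_cond : forall n, is_cond_expectation P (sigma_upto x n)
      (fun w => (`|c n w| ^+ 2)%:E) (Ec n))
    (Ea_summable :
      {ae P, forall w, (\sum_(0 <= n <oo) sqrte (Ea n w) < +oo)%E})
    (Ec_summable :
      {ae P, forall w, (\sum_(0 <= n <oo) sqrte (Ec n w) < +oo)%E})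
    (eps_indep : forall n,
      independent_systems P (sigma_sweep (eps n)) (sigma_upto x n))
    (eps_pos : forall i, (0 < P [set w | val (eps 0%N w) i])%E) :
  exists xlim : T -> hsum H,
    [/\ borel_rv xlim,
        forall w, inclusion_solutions A B (xlim w),
        {ae P, forall w, weak_cvg (fun n => x n w) (xlim w)} &
        (forall z i, inclusion_solutions A B z -> demiregular (A i) (z i)) \/
        (forall z, inclusion_solutions A B z ->
           demiregular (fun y : hsum H => [set ((fun i => B i y) : hsum H)]) z) ->
        {ae P, forall w, x n w @[n --> \oo] --> xlim w}].
Proof.
have sH : separable (hsum H) by exact: hsum_separable.
have [z0 z0S] := F_nonempty.
pose g0 := inf (range gamma); pose g1 := sup (range gamma).
pose l0 := inf (range lambda).
have gamma_bnd n : g0 <= gamma n <= g1.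
  apply/andP; split.
    apply: ge_inf; last by exists n.
    by exists 0 => _ [k _ <-]; case/andP: (gamma_in k) => /ltW.
  apply: sup_upper_bound; last by exists n.
  split; first by exists (gamma 0%N); exists 0%N.
  by exists (2 * theta) => _ [k _ <-]; case/andP: (gamma_in k) => _ /ltW.
have lambda_bnd n : l0 <= lambda n.
  apply: ge_inf; last by exists n.
  by exists 0 => _ [k _ <-]; case/andP: (lambda_in k) => /ltW.
(* one constant below both coefficients in the decrease of the full step *)
pose k := Num.min l0 (l0 * (g0 * (2 * theta - g1))).
have gap0 : 0 < 2 * theta - g1 by rewrite subr_gt0.
have k0 : 0 < k by rewrite lt_min lambda_inf !mulr_gt0.
have k_le n : k <= lambda n by rewrite ge_min lambda_bnd.
have k_le' n : k <= lambda n * (gamma n * (2 * theta - gamma n)).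
  rewrite ge_min; apply/orP; right; case/andP: (gamma_bnd n) => h1 h2.
  apply: ler_pM => //; [exact: ltW|by rewrite mulr_ge0// ltW|].
  by apply: ler_pM => //; [exact: ltW|exact: ltW|rewrite lerD2l lerN2].
have subG n : <<s past x n >> `<=` measurable.
  exact: (past_measurable H_separable A_maxmon theta_gt0 B_cocoercive gamma_in
    lambda_in x0_rv a_rv c_rv eps_rv x_iter).
(* summability forces the conditional expectations to be almost surely finite,
   so that real-valued versions exist *)
have bounded (E : nat -> T -> \bar R) : (forall n w, (0 <= E n w)%E) ->
    {ae P, forall w, (\sum_(0 <= n <oo) sqrte (E n w) < +oo)%E} ->
    {ae P, forall w, (forall n, (E n w < +oo)%E) /\
      exists M, forall n, \sum_(k < n) Num.sqrt (fine (E k w)) <= M}.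
  move=> E0; apply: filterS => w; exact: sqrte_series_bounded.
have Ea0 n w : (0 <= Ea n w)%E by case: (Ea_cond n).
have Ec0 n w : (0 <= Ec n w)%E by case: (Ec_cond n).
have Ea_bnd := bounded _ Ea0 Ea_summable.
have Ec_bnd := bounded _ Ec0 Ec_summable.
have Ea_fine n : [/\ sub_measurable (past x n) (fine \o Ea n),
    forall w, 0 <= fine (Ea n w) &
    forall U, <<s past x n >> U -> (\int[P]_(w in U) (`|a n w| ^+ 2)%:E =
      \int[P]_(w in U) (fine (Ea n w))%:E)%E].
  apply: (cond_expectation_fine (subG n) (Ea_cond n)).
  by apply: filterS Ea_bnd => w [].
have Ec_fine n : [/\ sub_measurable (past x n) (fine \o Ec n),
    forall w, 0 <= fine (Ec n w) &
    forall U, <<s past x n >> U -> (\int[P]_(w in U) (`|c n w| ^+ 2)%:E =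
      \int[P]_(w in U) (fine (Ec n w))%:E)%E].
  apply: (cond_expectation_fine (subG n) (Ec_cond n)).
  by apply: filterS Ec_bnd => w [].
pose ea n w : R := fine (Ea n w); pose ec n w : R := fine (Ec n w).
have ea0 n w : 0 <= ea n w by have [_ + _] := Ea_fine n; exact.
have mea n : sub_measurable (past x n) (ea n).
  by have [h _ _] := Ea_fine n; exact: h.
have ea_cond n U : <<s past x n >> U -> (\int[P]_(w in U) (`|a n w| ^+ 2)%:E =
    \int[P]_(w in U) (ea n w)%:E)%E.
  by have [_ _ h] := Ea_fine n; exact: h.
have ec0 n w : 0 <= ec n w by have [_ + _] := Ec_fine n; exact.
have mec n : sub_measurable (past x n) (ec n).
  by have [h _ _] := Ec_fine n; exact: h.
have ec_cond n U : <<s past x n >> U -> (\int[P]_(w in U) (`|c n w| ^+ 2)%:E =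
    \int[P]_(w in U) (ec n w)%:E)%E.
  by have [_ _ h] := Ec_fine n; exact: h.
(* any positive summable sequence would serve as the slack in Jensen's
   inequality *)
pose r n : R := 2^-1 ^+ n.
have r0 n : 0 < r n by rewrite exprn_gt0// invr_gt0.
pose wt := weight (P := P) eps.
have almost_fejer z : inclusion_solutions A B z -> {ae P, forall w,
    cvg (`|wscale wt (x n w - z)| @[n --> \oo]) /\
    gain_proc (P := P) A B gamma x eps k z n w @[n --> \oo] --> (0 : R)}.
  move=> zS.
  apply: (almost_supermartingale_cvg (P := P) subG (past_filtration (x := x))
    (v := dist_proc (P := P) x eps z)
    (u := gain_proc (P := P) A B gamma x eps k z)
    (e := error_proc (P := P) theta eps ea ec r)) => //.
  - by move=> n w; exact: normr_ge0.
  - by move=> n w; apply: gain_ge0 => //; exact: ltW.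
  - by move=> n w; apply: error_ge0.
  - by move=> n; apply: dist_adapted.
  - by move=> n; apply: (gain_adapted A_maxmon theta_gt0 B_cocoercive gamma_in).
  - by move=> n; apply: error_adapted.
  - move=> n U GU; exact: (mean_step H_separable A_maxmon theta_gt0 B_cocoercive
      gamma_in lambda_in x0_rv a_rv c_rv eps_rv eps_id x_iter eps_indep eps_pos
      r0 ea0 ec0 mea mec ea_cond ec_cond (ltW k0) k_le k_le' zS GU).
  - apply: filterS2 Ea_bnd Ec_bnd => w [_ Ma] [_ Mc].
    apply: error_bounded => //; exists 2 => n; exact: half_series_bounded.
have [zs [zsS zs_dense]] := separable_subset_seq sH F_nonempty.
pose goal w p := [/\ inclusion_solutions A B p, weak_cvg (fun n => x n w) p &
  (forall z i, inclusion_solutions A B z -> demiregular (A i) (z i)) \/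
  (forall z, inclusion_solutions A B z ->
    demiregular (fun y : hsum H => [set ((fun i => B i y) : hsum H)]) z) ->
  x n w @[n --> \oo] --> p].
have wt1 i : 1 <= wt i by exact: weight_ge1.
(* countably many solutions, dense among all, give one almost sure event *)
have good : {ae P, forall w, exists p, goal w p}.
  have all_zs : {ae P, forall w, forall j,
      cvg (`|wscale wt (x n w - zs j)| @[n --> \oo]) /\
      gain_proc (P := P) A B gamma x eps k (zs j) n w @[n --> \oo] --> (0 : R)}.
    by apply: ae_foralln => j; exact: almost_fejer.
  apply: filterS all_zs => w all_zs.
  have fejer z : inclusion_solutions A B z ->
      cvg (`|wscale wt (x n w - z)| @[n --> \oo]).
    move=> zS.
    apply: (@wdist_cvg_dense _ _ _ wt (1 + \sum_i wt i) (fun n => x n w) zs).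
    + rewrite ltr_wpDr// sumr_ge0// => i _; exact: le_trans (wt1 i).
    + move=> y; exact: wscale_weight_le.
    + by move=> j; case: (all_zs j).
    + by move=> e e0; exact: zs_dense.
  have [cvg0 gain0] := all_zs 0%N.
  have res0 : residual A B (gamma n) (zs 0%N) (x n w) @[n --> \oo] --> (0 : R).
    have /cvg_ex[l /= hl] := cvg0.
    rewrite (_ : (fun n => _) = fun n =>
        gain_proc (P := P) A B gamma x eps k (zs 0%N) n w *
        (2 * (dist_proc (P := P) x eps (zs 0%N) n w + 1) / k)); last first.
      apply/funext => n; rewrite /gain_proc; field.
      rewrite gt_eqF// gt_eqF// ltr_wpDl//; exact: normr_ge0.
    rewrite -[X in _ --> X](mul0r (2 * (l + 1) / k)).
    apply: cvgM => //; apply: cvgMr_tmp; apply: cvgMl_tmp.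
    by apply: cvgD => //; exact: cvg_cst.
  have sqrt_res0 : Num.sqrt (residual A B (gamma n) (zs 0%N) (x n w))
      @[n --> \oo] --> (0 : R).
    rewrite -[X in _ --> X]sqrtr0.
    exact: (cvg_comp _ Num.sqrt res0 (@sqrt_continuous R 0)).
  have le_sqrt (s t : R) : 0 <= s -> 0 <= t -> s ^+ 2 <= t -> s <= Num.sqrt t.
    by move=> s0 t0 st; rewrite -[leLHS]ger0_norm// -sqrtr_sqr ler_wsqrtr.
  have := @fwd_bwd_cvg _ _ _ A B A_maxmon theta theta_gt0 B_cocoercive gamma g0 g1
    gamma_inf gamma_bnd (fun n => x n w) (zs 0%N) (zsS 0%N) _ _ wt wt1 fejer.
  apply.
  - apply/subr_cvg0; apply: (@norm_le_cvg0 _ _ _ _ _ _ _ _ sqrt_res0) => n.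
    by apply: le_sqrt => //; [exact: residual_ge0|rewrite lerDl sqr_ge0].
  - apply: (@norm_le_cvg0 _ _ _ _ _ _ _ _ sqrt_res0) => n.
    by apply: le_sqrt => //; [exact: residual_ge0|rewrite lerDr sqr_ge0].
(* on a measurable null set containing the exceptional event the limit is reset
   to z0, which keeps it measurable and a solution everywhere *)
have [N [mN PN badN]] := good.
have limit w : exists p, (w \in N -> p = z0) /\ (w \notin N -> goal w p).
  case: (boolP (w \in N)) => wN; first by exists z0.
  have [p gp] : exists p, goal w p.
    by apply: contrapT => bad; move/negP: wN; apply; rewrite inE; exact: badN.
  by exists p.
have /choice[xlim xlimP] := limit.
have ae_good : {ae P, forall w, w \notin N}.
  by exists N; split => // w /= /negP; rewrite negbK inE.
exists xlim; split.
- apply: (@borel_rv_weak_cvg _ _ _ (hsum H)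
    (fun n w => if w \in N then z0 else x n w)) => //.
    move=> n; apply: borel_rv_open => O oO.
    have mx : borel_rv (x n).
      exact: (iterate_borel H_separable A_maxmon theta_gt0 B_cocoercive gamma_in
        lambda_in x0_rv a_rv c_rv eps_rv x_iter).
    rewrite (_ : _ @^-1` O = (N `&` [set w | O z0]) `|` (~` N `&` x n @^-1` O)).
      apply: measurableU.
        apply: measurableI => //; case: (pselect (O z0)) => Oz.
          by rewrite (_ : [set w | _] = setT)//; apply/seteqP; split.
        by rewrite (_ : [set w | _] = set0)//; apply/seteqP; split.
      apply: measurableI; first exact: measurableC.
      exact: (borel_rv_measurable mx oO).
    apply/seteqP; split=> w /=.
      by case: (boolP (w \in N)) => [/set_mem wN Ow|/negP wN Ow]; [left|right;
        split => // /mem_set].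
    case: (boolP (w \in N)) => [/set_mem wN|/negP wN] [[Nw Ow]|[Nw Ow]] //.
    by have := mem_set Nw.
  move=> w; case: (boolP (w \in N)) => wN.
    by rewrite (xlimP w).1// => y; exact: cvg_cst.
  by case: ((xlimP w).2 wN).
- move=> w; case: (boolP (w \in N)) => wN; first by rewrite (xlimP w).1.
  by case: ((xlimP w).2 wN).
- by apply: filterS ae_good => w wN; case: ((xlimP w).2 wN).
- move=> demi; apply: filterS ae_good => w wN.
  by case: ((xlimP w).2 wN) => _ _; exact.
Qed.
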